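(* The degree $2$ $A_\infty$-natural transformations (one representative from each cohomology class) $$\eta_{\{\vartheta\}}:\mathrm{id}\Rightarrow\beta_{i^-},\qquad \{\vartheta_1,\dots,\vartheta_{i-1},\vartheta_{i+1},\dots,\vartheta_{N-1}\}\in\Bbbk^{N-2}\cong\mathrm{HH}^2(\mathfrak B_{i^-}),$$ are given by $$\eta^2(a_{lk}s^\beta,a_{kj}s^\alpha)=\begin{cases}\mathfrak c(a_{lk}s^\beta,a_{kj}s^\alpha)\,a_{lj}s^{\beta+\alpha+\delta(j,k,l)-1},&l\ne i,\\ \mathfrak c(a_{ik}s^\beta,a_{kj}s^\alpha)\,a_{i+\operatorname{sgn}(j-i),j}s^{\beta+\alpha+\delta(j,k,i)-1},&l=i\ne j,\\ \mathfrak c(a_{ik}s^\beta,a_{ki}s^\alpha)\,\big[\tfrac12q_{i-1}s^{\beta+\alpha+|i-k|-2},\ \tfrac12p_{i+1}s^{\beta+\alpha+|i-k|-2}\big],&l=j=i,\end{cases}$$ $$\eta^3(a_{ml}s^\gamma,a_{lk}s^\beta,a_{kj}s^\alpha)=\begin{cases}0,&m\ne i,\\ \mathfrak C(a_{il}s^\gamma,a_{lk}s^\beta,a_{kj}s^\alpha)\,a_{ij}s^{\gamma+\beta+\alpha+\delta(j,k,l,i)-2},&m=i,\end{cases}$$ $$\eta^0=\eta^1=\eta^4=\cdots=0,$$ where $\mathfrak c$ is the coefficient function defined in the context, in which one sets $\vartheta_0=\vartheta_i=\vartheta_N=0$; where $$\delta(i,j,k,l)=\delta(i,j,l)+\delta(j,k,l)=\delta(i,k,l)+\delta(i,j,k)=\tfrac12\big(|i-j|+|j-k|+|k-l|-|i-l|\big)$$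 (the number of dots in $a_{lk}a_{kj}a_{ji}$); and where, for $a_3=a_{il}s^\gamma$, $a_2=a_{lk}s^\beta$, $a_1=a_{kj}s^\alpha$, $$\mathfrak C(a_3,a_2,a_1)=\begin{cases}\frac12\Big(\big(-\operatorname{sgn}(j-i)+\operatorname{sgn}(k-i)\big)\mathfrak c(a_3,a_2)+\big(\operatorname{sgn}(j-i)-\operatorname{sgn}(l-i)\big)\mathfrak c(a_2,a_1)\Big),&l\ne i,\\ \frac12\big(-\operatorname{sgn}(j-i)+\operatorname{sgn}(k-i)\big)\mathfrak c(a_3,a_2),&l=i.\end{cases}$$
   Context: Let $\Bbbk$ be a field, let $N=|\mathbf x|$ be the number of punctures $x_1,\dots,x_N$, and let $1\le i\le N-1$ (the functor $\beta_{i^-}$ exchanges $x_i$ and $x_{i+1}$). $\mathcal C$ is the $\Bbbk$-linear category (concentrated in degree $0$, only $\mu^2$ nonzero) with objects $T_0,\dots,T_N$, where $\operatorname{Hom}(T_i,T_j)$ has $\Bbbk$-basis $\{a_{ji}s^\alpha\}_{\alpha\ge0}$ and composition $a_{kj}s^\beta\cdot a_{ji}s^\alpha=a_{ki}s^{\alpha+\beta+\delta(i,j,k)}$, $\delta(i,j,k)=\frac12(|i-j|+|j-k|-|i-k|)$. Notation: $s_i^\alpha=a_{ii}s^\alpha$, $p_i=a_{i,i-1}$, $q_i=a_{i,i+1}$, $q_{i-1}s^\alpha=a_{i-1,i}s^\alpha$, $p_{i+1}s^\alpha=a_{i+1,i}s^\alpha$; $\operatorname{sgn}(0)=0$. Terms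 with zero coefficient are read as $0$, whatever the exponent of $s$. Coefficient function: for $0\le u,v,w\le N$ and $\alpha,\beta\ge0$, $$\mathfrak c(a_{wv}s^\beta,a_{vu}s^\alpha)=\begin{cases} -\beta\vartheta_v-\sum_{t=1}^{v-w}2(\beta+t)\vartheta_{v-t}-2(\beta+v-w)\sum_{t=u}^{w-1}\vartheta_t+(\beta+v-w)\vartheta_u,& u<w\le v,\\ \beta\vartheta_v+\sum_{t=1}^{w-v}2(\beta+t)\vartheta_{v+t}+2(\beta+w-v)\sum_{t=w+1}^{u}\vartheta_t-(\beta+w-v)\vartheta_u,& v\le w<u,\\ -\beta\vartheta_v-\sum_{t=1}^{v-u}2(\beta+t)\vartheta_{v-t}+(\beta+v-u)\vartheta_u,& w\le u<v,\\ \beta\vartheta_v+\sum_{t=1}^{u-v}2(\beta+t)\vartheta_{v+t}-(\beta+u-v)\vartheta_u,& v<u\le w,\\ 0,&\text{else.} \end{cases}$$ $\mathrm{Tw}^b(\mathcal C)$ is the category of bounded complexes over $\mathcal C$: objects carry a differential $\delta$, morphisms are graded matrices of morphisms, $\mu^1_\delta(x)=(-1)^{|x|}\delta x-x\delta$, $\mu^2_\delta(x_2,x_1)=(-1)^{|x_1|}x_2x_1$ (naive products on the right), and $\mu_\delta^{d}=0$ for $d\geq3$. The negative braiding functor $\beta_{i^-}:\mathcal C\to\mathrm{Tw}^b(\mathcal C)$ (extended to $\mathrm{Tw}^b(\mathcal C)$) is the following $A_\infty$-functor. Objects: $\beta_{i^-}T_j=T_j$ for $j\ne i$; $\beta_{i^-}T_i=\big(T_i\xrightarrow{[q_{i-1},\,-p_{i+1}]}T_{i-1}\oplus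 T_{i+1}\big)$ with $T_i$ in degree $-1$ and $T_{i-1}\oplus T_{i+1}$ in degree $0$. First component $\beta_{i^-}^1$ (degree $0$): (a) $a_{kj}s^\alpha\mapsto a_{kj}s^\alpha$ if $j,k\ne i$; (b) $a_{ij}s^\alpha$ with $j>i$ (resp. $j<i$) maps to $a_{i+1,j}s^\alpha:T_j\to T_{i+1}$ (resp. $a_{i-1,j}s^\alpha:T_j\to T_{i-1}$); (c) $a_{ki}s^\alpha$ with $k>i$ maps to the morphism with components $a_{k,i-1}s^\alpha$ on $T_{i-1}$ and $a_{k,i+1}s^{\alpha+1}$ on $T_{i+1}$, and with $k<i$ to the morphism with components $a_{k,i-1}s^{\alpha+1}$ on $T_{i-1}$ and $a_{k,i+1}s^\alpha$ on $T_{i+1}$; (d) $s_i^\alpha$ maps to the diagonal morphism with entries $s_i^\alpha,s_{i-1}^\alpha,s_{i+1}^\alpha$. Second component $\beta_{i^-}^2(a_{lk}s^\beta,a_{kj}s^\alpha)$ (degree $-1$): it is $0$ if $l\neq i$; if $l=i\ne j$ it is $0$ when $(i-j)(i-k)\ge0$, and $\operatorname{sgn}(i-k)a_{ij}s^{\beta+\alpha+|i-k|-1}$ into the degree $-1$ term $T_i$ when $(i-j)(i-k)<0$; if $l=j=i$ it is $\operatorname{sgn}(i-k)\,a_{i,i+\operatorname{sgn}(i-k)}s^{\beta+\alpha+|i-k|-1}$ from the summand $T_{i+\operatorname{sgn}(i-k)}$ of the degree $0$ term to the degree $-1$ term $T_i$ (so $0$ if $k=i$). $\beta_{i^-}^d=0$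 for $d\ge3$. The associated $(\mathcal C,\mathcal C)$-bimodule is denoted $\mathfrak B_{i^-}$. The values of $\eta^2$ for $l=i$ are degree $0$ morphisms into the degree $0$ term $T_{i-1}\oplus T_{i+1}$ of $\beta_{i^-}T_i$ (with $[x,y]$ having components $x:T_i\to T_{i-1}$, $y:T_i\to T_{i+1}$, and $a_{i\pm1,j}s^{\bullet}$ landing in $T_{i\pm1}$); the values of $\eta^3$ for $m=i$ are degree $-1$ morphisms into the degree $-1$ term $T_i$. A degree $g$ pre-natural transformation $\eta:\mathrm{id}\Rightarrow\beta_{i^-}$ consists of multilinear maps $\eta^d:\operatorname{Hom}(X_{d-1},X_d)\otimes\cdots\otimes\operatorname{Hom}(X_0,X_1)\to\operatorname{Hom}^{g-d}(X_0,\beta_{i^-}X_d)$, $d\ge0$, on objects $X_m$ of $\mathcal C$. The differential is $$\begin{aligned}\mu^1(\eta)^d(a_d,\dots,a_1)=\;&\mu^1_\delta\big(\eta^d(a_d,\dots,a_1)\big)+\sum_{m=0}^{d-1}\mu^2_\delta\big(\beta_{i^-}^{d-m}(a_d,\dots,a_{m+1}),\eta^m(a_m,\dots,a_1)\big)\\&+(-1)^{g-1}\mu^2_\delta\big(\eta^{d-1}(a_d,\dots,a_2),a_1\big)-\sum_{n=0}^{d-2}(-1)^{n+g-1}\eta^{d-1}(a_d,\dots,a_{n+2}\cdot a_{n+1},\dots,a_1)\end{aligned}$$ (terms with $\eta^{d-1}$ absent for $d=0$). $\eta$ is an $A_\infty$-natural transformation if $\mu^1(\eta)=0$; $\mathrm{HH}^g(\mathfrak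 B_{i^-})=H^g\operatorname{Hom}(\mathrm{id},\beta_{i^-})$ is the degree-$g$ cohomology of this complex.
   Formalization: The characteristic is assumed not 2 (the formulas contain 1/2), and c is not 0 for u<v<w and w<v<u but takes the expressions of its first and second cases at w=v; with the printed 0, η is not closed (N=3, i=1, a_30, a_02, a_20). *)

(* Defs.v *)
From HB Require Import structures.
From mathcomp Require Import all_boot all_order all_algebra.

Set Implicit Arguments.
Unset Strict Implicit.
Unset Printing Implicit Defensive.

Import Order.TTheory GRing.Theory Num.Theory.
Local Open Scope ring_scope.

Definition dist (u v : nat) : nat := `|u%:Z - v%:Z|%N.

(* The sum of distances is always even and at least [dist u w]. *)
Definition dots (u v w : nat) : nat := (dist u v + dist v w - dist u w)./2.

Definition dots4 (u v w x : nat) : nat := (dots u v x + dots v w x)%N.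

Section Category.
Variables (k : fieldType) (N : nat).

(* The ordinal [j] stands for the object T_j.  Every Hom(T_i, T_j) is
   {poly k}, the monomial 'X^a standing for a_{ji} s^a. *)
Notation obj := 'I_N.+1.

Definition cmul (z y x : obj) (f g : {poly k}) : {poly k} :=
  f * g * 'X^(dots x y z).

(* [chain x d z] is the set of composable sequences (a_d, ..., a_1) of
   morphisms with a_1 starting at x and a_d ending at z; the outermost [ccons]
   carries a_d. *)
Inductive chain (x : obj) : nat -> obj -> Type :=
| cnil : chain x 0 x
| ccons (d : nat) (y z : obj) (a : {poly k}) (p : chain x d y) :
    chain x d.+1 z.

(* Pairs (X_m, a_m), listed from m = d down to m = 1. *)
Fixpoint steps x d z (p : chain x d z) : seq (obj * {poly k}) :=
  match p with
  | cnil => [::]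
  | ccons _ _ z a q => (z, a) :: steps q
  end.

(* [slot_comb c p p1 p2]: the three sequences agree except in one slot, where
   the entry of p is c times that of p1 plus that of p2. *)
Inductive slot_comb (c : k) (x : obj) :
    forall d z, chain x d z -> chain x d z -> chain x d z -> Prop :=
| slot_here d y z (a b : {poly k}) (p : chain x d y) :
    slot_comb c (ccons z (c *: a + b) p) (ccons z a p) (ccons z b p)
| slot_there d y z (a : {poly k}) (p p1 p2 : chain x d y) :
    slot_comb c p p1 p2 ->
    slot_comb c (ccons z a p) (ccons z a p1) (ccons z a p2).

(* Sum of G (a_d, ..., a_{m+1}) (a_m, ..., a_1) over 0 <= m < d. *)
Fixpoint sum_splits (V : zmodType) x d z (p : chain x d z) :
    (forall y e m, chain y e z -> chain x m y -> V) -> V :=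
  match p in chain _ _ z
    return (forall y e m, chain y e z -> chain x m y -> V) -> V with
  | cnil => fun _ => 0
  | ccons d y z a q => fun G =>
      G y 1%N d (ccons z a (cnil y)) q
      + sum_splits q (fun y' e m r s => G y' e.+1 m (ccons z a r) s)
  end.

(* G (a_d, ..., a_2) a_1, and 0 when d = 0. *)
Fixpoint split_first (V : zmodType) x d z (p : chain x d z) :
    (forall y e, chain y e z -> {poly k} -> V) -> V :=
  match p in chain _ _ z
    return (forall y e, chain y e z -> {poly k} -> V) -> V with
  | cnil => fun _ => 0
  | ccons d y z a q => fun G =>
      if d is 0 then G z 0%N (cnil z) a
      else split_first q (fun y' e r b => G y' e.+1 (ccons z a r) b)
  end.

(* Sum of G n (a_d, ..., a_{n+2} a_{n+1}, ..., a_1) over 0 <= n <= d - 2. *)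
Fixpoint sum_merges (V : zmodType) x d z (p : chain x d z) :
    (nat -> forall e, chain x e z -> V) -> V :=
  match p in chain _ _ z return (nat -> forall e, chain x e z -> V) -> V with
  | cnil => fun _ => 0
  | ccons d y z a q => fun G =>
      match q with
      | cnil => 0
      | ccons n y' y b r => G n n.+1 (ccons z (cmul z y y' a b) r)
      end
      + sum_merges q (fun n e r => G n e.+1 (ccons z a r))
  end.

Definition mxmulC (nz ny nx : nat)
    (oz : 'I_nz -> obj) (oy : 'I_ny -> obj) (ox : 'I_nx -> obj)
    (f : 'M[{poly k}]_(nz, ny)) (g : 'M[{poly k}]_(ny, nx)) :
    'M[{poly k}]_(nz, nx) :=
  \matrix_(r, c) \sum_m cmul (oz r) (oy m) (ox c) (f r m) (g m c).

(* Bounded complexes over the category: finite formal sums of shifted objects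
   with a differential of degree 1. *)
Record twobj := TwObj {
  tsize : nat;
  tobj : 'I_tsize -> obj;
  tdeg : 'I_tsize -> int;
  tdiff : 'M[{poly k}]_tsize;
  tdiff_deg : forall r c, tdiff r c != 0 -> tdeg r = tdeg c + 1;
  tdiff_sq : mxmulC tobj tobj tobj tdiff tdiff = 0 }.

Notation twhom X Y := 'M[{poly k}]_(tsize Y, tsize X).

Definition twhomog (X Y : twobj) (n : int) (f : twhom X Y) : Prop :=
  forall r c, f r c != 0 -> tdeg r = tdeg c + n.

Definition twmul (X Y Z : twobj) (f : twhom Y Z) (g : twhom X Y) : twhom X Z :=
  mxmulC (@tobj Z) (@tobj Y) (@tobj X) f g.

Definition psign (n : int) : {poly k} := (-1) ^+ `|n|%N.

(* [n] is the degree of f. *)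
Definition twmu1 (X Y : twobj) (n : int) (f : twhom X Y) : twhom X Y :=
  psign n *: twmul (tdiff Y) f - twmul f (tdiff X).

(* [n] is the degree of the first morphism g. *)
Definition twmu2 (X Y Z : twobj) (n : int) (f : twhom Y Z) (g : twhom X Y) :
    twhom X Z :=
  psign n *: twmul f g.

Fact one_diff_deg (r c : 'I_1) :
  (0 : 'M[{poly k}]_1) r c != 0 -> (0 : int) = 0 + 1.
Proof. by rewrite mxE eqxx. Qed.

Fact one_diff_sq (x : obj) :
  let o := fun _ : 'I_1 => x in mxmulC o o o 0 0 = 0.
Proof.
by move=> o; apply/matrixP=> r c; rewrite !mxE big1 // => m _; rewrite /cmul mxE !mul0r.
Qed.

(* T_x as a complex concentrated in degree 0. *)
Definition one (x : obj) : twobj :=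
  @TwObj 1 (fun=> x) (fun=> 0) 0 one_diff_deg (one_diff_sq x).

(* Data of an A_oo-functor from the category to its bounded complexes; only
   the components of positive arity are meaningful. *)
Record functor_data := FunctorData {
  fobj : obj -> twobj;
  fmor : forall x d z, chain x d z -> twhom (fobj x) (fobj z) }.

Section PreNatural.
Variable F : functor_data.

Definition prenat := forall x d z, chain x d z -> twhom (one x) (fobj F z).

Definition is_prenat (g : int) (eta : prenat) : Prop :=
  forall x d z,
    (forall p : chain x d z, twhomog (g - d%:Z) (eta x d z p)) /\
    (forall c (p p1 p2 : chain x d z), slot_comb c p p1 p2 ->
       eta x d z p = c%:P *: eta x d z p1 + eta x d z p2).

Definition nat_mu1 (g : int) (eta : prenat) : prenat := fun x d z p =>
  twmu1 (g - d%:Z) (eta x d z p)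
  + sum_splits p (fun y e m q r =>
      @twmu2 (one x) _ _ (g - m%:Z) (fmor F q) (eta x m y r))
  + psign (g - 1) *: split_first p (fun y e q a =>
      @twmu2 (one x) (one y) _ 0 (eta y e z q) (const_mx a))
  - sum_merges p (fun n e q => psign (n%:Z + g - 1) *: eta x e z q).

Definition is_nat_transf (g : int) (eta : prenat) : Prop :=
  is_prenat g eta /\ forall x d z (p : chain x d z), nat_mu1 g eta p = 0.

Definition cohomologous (g : int) (eta eta' : prenat) : Prop :=
  exists xi : prenat, is_prenat (g - 1) xi /\
    forall x d z (p : chain x d z),
      eta x d z p - eta' x d z p = nat_mu1 (g - 1) xi p.

End PreNatural.

Section Braiding.
Variable i : nat.

(* The summands of the complex assigned to T_i have indices 0, 1, 2 for T_i,
   T_{i-1}, T_{i+1} respectively. *)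
Definition cone_obj (r : 'I_3) : obj :=
  if val r == 0%N then inord i
  else if val r == 1%N then inord i.-1 else inord i.+1.

Definition cone_deg (r : 'I_3) : int := if val r == 0%N then -1 else 0.

Definition cone_diff : 'M[{poly k}]_3 := \matrix_(r, c)
  if val c == 0%N then
    if val r == 1%N then 1 else if val r == 2 then -1 else 0
  else 0.

Fact cone_diff_deg r c :
  cone_diff r c != 0 -> cone_deg r = cone_deg c + 1.
Proof.
rewrite mxE /cone_deg; case: (val c == 0%N); last by rewrite eqxx.
by case: r => [[|[|[|r]]] hr] //=; rewrite eqxx.
Qed.

Fact cone_diff_sq :
  mxmulC cone_obj cone_obj cone_obj cone_diff cone_diff = 0.
Proof.
apply/matrixP=> r c; rewrite !mxE big1 // => m _; rewrite /cmul !mxE.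
case: m => [[|[|[|m]]] hm] //=; rewrite ?mul0r //.
by case: (val c == 0%N); rewrite mulr0 mul0r.
Qed.

Definition cone : twobj := TwObj cone_diff_deg cone_diff_sq.

Definition beta_obj (j : obj) : twobj := if val j == i then cone else one j.

(* Index of the summand T_{i + sgn e} of [cone], for e <> 0. *)
Definition side (e : int) : nat := if 0 < e then 2 else 1.

Definition beta1 (j l : obj) (f : {poly k}) (r c : nat) : {poly k} :=
  match val l == i, val j == i with
  | false, false => f
  | true, false => if r == side (j%:Z - i%:Z) then f else 0
  | false, true =>
      if c == 1%N then (if (i < l)%N then f else f * 'X)
      else if c == 2 then (if (i < l)%N then f * 'X else f)
      else 0
  | true, true => if r == c then f else 0
  end.

Definition beta2 (j h l : obj) (f g : {poly k}) (r c : nat) : {poly k} :=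
  let e := i%:Z - h%:Z in
  let v := (sgz e)%:~R *: (f * g * 'X^(dist i h - 1)) in
  if val l != i then 0
  else if val j != i then
    if (r == 0%N) && ((i%:Z - j%:Z) * e < 0) then v else 0
  else if (r == 0%N) && (c == side e) then v else 0.

Definition beta_mor x d z (p : chain x d z) :
    twhom (beta_obj x) (beta_obj z) :=
  \matrix_(r, c) match steps p with
  | [:: (l, f)] => beta1 x l f r c
  | [:: (l, f); (h, g)] => beta2 x h l f g r c
  | _ => 0
  end.

Definition beta : functor_data := FunctorData beta_mor.

(* The parameters are indexed by {1, ..., N-1} minus i. *)
Definition theta_idx := {j : 'I_N | (0 < j)%N && (val j != i)}.

Definition theta_space := {ffun theta_idx -> k^o}.

Definition theta_ext (th : theta_space) (j : nat) : k :=
  oapp (th : theta_idx -> k) 0 (obind insub (insub j)).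

(* The coefficient of the pair (a_{wv} s^b, a_{vu} s^a); it does not depend on
   a.  The two strictly monotone cases at the end do not appear in the printed
   formula, where they fall under "else 0".  With the value 0 eta is not closed
   (already for N = 3, at a_{30}, a_{02}, a_{20} for i = 1), and closedness
   together with the other cases leaves only the values below, which are those
   of the first two cases at w = v. *)
Definition coef (th : nat -> k) (w v b u : nat) : k :=
  if (u < w <= v)%N then
    - (b%:R * th v)
    - \sum_(1 <= t < (v - w).+1) (2 * (b + t))%:R * th (v - t)%N
    - (2 * (b + (v - w)))%:R * (\sum_(u <= t < w) th t)
    + (b + (v - w))%:R * th u
  else if (v <= w < u)%N then
    b%:R * th v
    + \sum_(1 <= t < (w - v).+1) (2 * (b + t))%:R * th (v + t)%N
    + (2 * (b + (w - v)))%:R * (\sum_(w.+1 <= t < u.+1) th t)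
    - (b + (w - v))%:R * th u
  else if (w <= u < v)%N then
    - (b%:R * th v)
    - \sum_(1 <= t < (v - u).+1) (2 * (b + t))%:R * th (v - t)%N
    + (b + (v - u))%:R * th u
  else if (v < u <= w)%N then
    b%:R * th v
    + \sum_(1 <= t < (u - v).+1) (2 * (b + t))%:R * th (v + t)%N
    - (b + (u - v))%:R * th u
  else if (u < v < w)%N then
    - (b%:R * th v) - (2 * b)%:R * (\sum_(u <= t < v) th t) + b%:R * th u
  else if (w < v < u)%N then
    b%:R * th v + (2 * b)%:R * (\sum_(v.+1 <= t < u.+1) th t) - b%:R * th u
  else 0.

(* For (a_{il} s^c, a_{lh} s^b, a_{hj} s^a). *)
Definition coef3 (th : nat -> k) (l c h b j : nat) : k :=
  let sg (n : nat) : k := (sgz (n%:Z - i%:Z))%:~R in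
  if l != i then
    2^-1 * ((- sg j + sg h) * coef th i l c h
            + (sg j - sg l) * coef th l h b j)
  else 2^-1 * ((- sg j + sg h) * coef th i l c h).

(* In [eta2] and [eta3] the coefficient vanishes whenever the subtraction in
   the exponent of 'X is truncated. *)
Definition eta2 (th : nat -> k) (j h l : obj) (b a r : nat) : {poly k} :=
  let c := coef th l h b j in
  if val l != i then c *: 'X^(b + a + dots j h l - 1)
  else if val j != i then
    if r == side (j%:Z - i%:Z) then c *: 'X^(b + a + dots j h i - 1) else 0
  else if r == 0%N then 0 else (2^-1 * c) *: 'X^(b + a + dist i h - 2).

Definition eta3 (th : nat -> k) (j h l m : obj) (c b a r : nat) : {poly k} :=
  if val m != i then 0
  else if r == 0%N then
    coef3 th l c h b j *: 'X^(c + b + a + dots4 j h l i - 2)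
  else 0.

(* The multilinear extension of eta2 and eta3. *)
Definition eta (th : theta_space) : prenat beta := fun x d z p =>
  \matrix_(r, _) match steps p with
  | [:: (l, f2); (h, f1)] =>
      \sum_(b < size f2) \sum_(a < size f1)
        (f2`_b * f1`_a) *: eta2 (theta_ext th) x h l b a r
  | [:: (m, f3); (l, f2); (h, f1)] =>
      \sum_(c < size f3) \sum_(b < size f2) \sum_(a < size f1)
        (f3`_c * f2`_b * f1`_a) *: eta3 (theta_ext th) x h l m c b a r
  | _ => 0
  end.

End Braiding.
End Category.

Lemma card_theta_idx (N i : nat) :
  (0 < i < N)%N -> #|{: theta_idx N i}| = (N - 2)%N.
Proof.
case/andP=> i0 iN; have N0 : (0 < N)%N by apply: leq_trans iN.
rewrite card_sig.
have -> : #|[pred j : 'I_N | (0 < j)%N && (val j != i)]|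
          = #|~: [set Ordinal N0; Ordinal iN]|.
  by apply: eq_card => j; rewrite !inE negb_or -!val_eqE /= -lt0n.
have := cardsC [set Ordinal N0; Ordinal iN].
by rewrite cards2 -val_eqE /= eq_sym -lt0n i0 card_ord => /(congr1 (subn^~ 2));
  rewrite addKn.
Qed.

(* Main.v *)
From Pilot Require Import Defs.
From mathcomp Require Import all_boot all_order all_algebra.
From mathcomp Require Import zify ring.

(** The idea of the proof.

    For objects x and z, the morphisms from T_x to beta T_z form the complex
    Hom(T_x, T_z) when z <> i, and the injection of Hom(T_x, T_i) into
    Hom(T_x, T_{i-1}) + Hom(T_x, T_{i+1}) when z = i.  The map (p_i, q_i) from
    beta T_i to T_i ([pi_mx]) kills the differential and commutes strictly with
    the first component of beta.  It identifies the cohomology of the bimodule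
    with the ideal I of the category made of all morphisms, except that an
    endomorphism of T_i is required to be divisible by s.  When 2 is invertible
    the symmetric section [sect] and the retraction [retr] split the complex
    ([sect_retr]).

    For degree reasons a pre-natural transformation of degree 2 is a pair
    (eta^2, eta^3), and one of degree 1 is a pair (xi^1, xi^2).  The projection
    of eta^2 is a Hochschild 2-cochain with values in I, a cocycle when eta is
    closed.  As the differential is injective in degree -1 ([diff_inj]), eta^2
    determines eta^3, and the equations between morphisms of degree -1 follow
    from those between morphisms of degree 0.  So the theorem computes HH^2 of
    the category with values in I.

    The transformations eta are closed because over k[s, 1/s] their cochain is a
    coboundary: [coef_potential] writes the coefficient function through a
    potential, after which the cocycle identity is linear algebra
    ([coef_cocycle]).  Then eta^2 is the section of that cocycle, and eta^3 is
    the retraction of the defect of [sect] from being a bimodule map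
    ([entry_eta3_retr], [eta_diff3]).

    For the classification, the category is presented by the arrows p_v, q_v
    and the relations p_v q_{v-1} = q_v p_{v+1} at the vertices 0 < v < N.  The
    value of a 2-cocycle on the relation at v <> i has a constant term
    ([obstruction]).  It vanishes on coboundaries, since the composite of two
    opposite arrows is divisible by s, and it equals 2 theta_v on eta, which
    gives uniqueness.  Conversely, if all these constant terms vanish, then the
    arrows lift, relations included, to the square-zero extension of the
    category by I that the cocycle defines; the resulting splitting of the
    extension is a primitive of the cocycle ([splittingP]), and [sect] and
    [retr] turn it into a primitive of the transformation ([chi_exact]). *)

Set Implicit Arguments.
Unset Strict Implicit.
Unset Printing Implicit Defensive.
Global Set Bullet Behavior "Strict Subproofs".

Import Order.TTheory GRing.Theory Num.Theory.
Import Pilot.Defs.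
Local Open Scope ring_scope.

(** * Dots in a composite *)

Lemma dots2 u v w : (2 * dots u v w + dist u w = dist u v + dist v w)%N.
Proof. rewrite /dots /dist; lia. Qed.

(** This identity of exponents is the associativity of the category. *)
Lemma dotsA x y z w : (dots x z w + dots x y z = dots y z w + dots x y w)%N.
Proof. move: (dots2 x z w) (dots2 x y z) (dots2 y z w) (dots2 x y w); lia. Qed.

Lemma dots_end u v : dots u v v = 0%N.
Proof. rewrite /dots /dist; lia. Qed.

(** * Linear extension from monomials *)

Section LinExt.
Variable k : fieldType.
Implicit Types (F G : {poly k} -> {poly k}) (f g : {poly k}).

(** Linearity over the base field; morphism spaces between complexes are modules
    over the polynomials, so the scalars have to be kept apart. *)
Definition klinear F := forall c f g, F (c *: f + g) = c *: F f + F g.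

Lemma klinear0 F : klinear F -> F 0 = 0.
Proof.
by move=> lF; have := lF (-1) 0 0; rewrite scaler0 addr0 scaleN1r addNr.
Qed.

Lemma klinear_ext F G : klinear F -> klinear G ->
  (forall n, F 'X^n = G 'X^n) -> forall f, F f = G f.
Proof.
move=> lF lG E f; rewrite -[f]coefK poly_def.
elim/big_rec: _ => [|j g _ IH]; first by rewrite !klinear0.
by rewrite lF lG E IH.
Qed.

Definition lin_of (m : nat -> {poly k}) (f : {poly k}) : {poly k} :=
  \sum_(a < size f) f`_a *: m a.

Lemma lin_of_widen m f n : (size f <= n)%N ->
  lin_of m f = \sum_(a < n) f`_a *: m a.
Proof.
move=> fn; rewrite /lin_of (big_ord_widen n (fun a => f`_a *: m a)) // big_mkcond.
apply: eq_bigr => a _; case: ltnP => // fa.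
by rewrite (nth_default _ fa) scale0r.
Qed.

Lemma lin_of_klinear m : klinear (lin_of m).
Proof.
move=> c f g; pose n := maxn (size (c *: f + g)) (maxn (size f) (size g)).
rewrite !(@lin_of_widen _ _ n) ?leq_max ?leqnn ?orbT //.
rewrite scaler_sumr -big_split; apply: eq_bigr => a _.
by rewrite coefD coefZ scalerDl scalerA.
Qed.

Lemma lin_ofX m n : lin_of m 'X^n = m n.
Proof.
rewrite /lin_of size_polyXn big_ord_recr /= coefXn eqxx scale1r big1 ?add0r //.
by move=> a _; rewrite coefXn ltn_eqF // scale0r.
Qed.

Lemma lin_of_param (F : nat -> {poly k} -> {poly k}) f :
  (forall b, klinear (F b)) -> klinear (fun g => lin_of (F^~ g) f).
Proof.
move=> lF c g g'; rewrite /lin_of scaler_sumr -big_split; apply: eq_bigr => b _.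
by rewrite lF /= scalerDr !scalerA mulrC.
Qed.

Lemma klinear_lin_of F m f : klinear F -> F (lin_of m f) = lin_of (F \o m) f.
Proof.
move=> lF; apply: (klinear_ext (F := fun f => F (lin_of m f))) => [c f1 f2||n].
- by rewrite lin_of_klinear lF.
- exact: lin_of_klinear.
- by rewrite !lin_ofX.
Qed.

Lemma eq_lin_of m m' f : m =1 m' -> lin_of m f = lin_of m' f.
Proof. by move=> E; apply: eq_bigr => a _; rewrite E. Qed.

(** Brings the double sum that defines eta^2 into a form to which the
    linearity lemmas apply slot by slot. *)
Lemma lin_of2E (m : nat -> nat -> {poly k}) f g :
  \sum_(b < size f) \sum_(a < size g) (f`_b * g`_a) *: m b a =
  lin_of (fun b => lin_of (m b) g) f.
Proof.
apply: eq_bigr => b _; rewrite scaler_sumr; apply: eq_bigr => a _.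
by rewrite scalerA.
Qed.

Lemma lin_of3E (m : nat -> nat -> nat -> {poly k}) f g (h : {poly k}) :
  \sum_(c < size f) \sum_(b < size g) \sum_(a < size h)
    (f`_c * g`_b * h`_a) *: m c b a =
  lin_of (fun c => lin_of (fun b => lin_of (m c b) h) g) f.
Proof.
apply: eq_bigr => c _; rewrite -lin_of2E scaler_sumr; apply: eq_bigr => b _.
rewrite scaler_sumr; apply: eq_bigr => a _.
by rewrite scalerA mulrA.
Qed.

Lemma lin_of2_r (m : nat -> nat -> {poly k}) f :
  klinear (fun g => lin_of (fun b => lin_of (m b) g) f).
Proof.
exact: (lin_of_param (F := fun b g => lin_of (m b) g) _ (fun b => lin_of_klinear _)).
Qed.

Lemma lin_of3_m (m : nat -> nat -> nat -> {poly k}) f h :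
  klinear (fun g => lin_of (fun c => lin_of (fun b => lin_of (m c b) h) g) f).
Proof.
apply: (lin_of_param (F := fun c g => lin_of (fun b => lin_of (m c b) h) g)) => c.
exact: lin_of_klinear.
Qed.

Lemma lin_of3_r (m : nat -> nat -> nat -> {poly k}) f g :
  klinear (fun h => lin_of (fun c => lin_of (fun b => lin_of (m c b) h) g) f).
Proof.
apply: (lin_of_param (F := fun c h => lin_of (fun b => lin_of (m c b) h) g)) => c.
exact: lin_of2_r.
Qed.

Lemma lin_of_linear c (m m1 m2 : nat -> {poly k}) f :
  (forall n, m n = c *: m1 n + m2 n) ->
  lin_of m f = c *: lin_of m1 f + lin_of m2 f.
Proof.
move=> mE; rewrite /lin_of scaler_sumr -big_split; apply: eq_bigr => a _.
by rewrite mE scalerDr !scalerA mulrC.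
Qed.

End LinExt.

(** * Composition *)

Section Composition.
Variable k : fieldType.

(** Composition indexed by natural numbers, which allows the inductions over
    vertices below. *)
Definition ncmul (z y x : nat) (f g : {poly k}) := f * g * 'X^(dots x y z).

Lemma ncmulA (x y z w : nat) (f g h : {poly k}) :
  ncmul w z x f (ncmul z y x g h) = ncmul w y x (ncmul w z y f g) h.
Proof.
rewrite /ncmul.
have XX : 'X^(dots x z w) * 'X^(dots x y z)
         = 'X^(dots y z w) * 'X^(dots x y w) :> {poly k}.
  by rewrite -!exprD dotsA.
transitivity (f * g * h * ('X^(dots x z w) * 'X^(dots x y z))); first by ring.
by rewrite XX; ring.
Qed.

Lemma ncmulDl w v u f f' g :
  ncmul w v u (f + f') g = ncmul w v u f g + ncmul w v u f' g.
Proof. by rewrite /ncmul; ring. Qed.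
Lemma ncmulDr w v u f g g' :
  ncmul w v u f (g + g') = ncmul w v u f g + ncmul w v u f g'.
Proof. by rewrite /ncmul; ring. Qed.
Lemma ncmulNl w v u f g : ncmul w v u (- f) g = - ncmul w v u f g.
Proof. by rewrite /ncmul; ring. Qed.
Lemma ncmulNr w v u f g : ncmul w v u f (- g) = - ncmul w v u f g.
Proof. by rewrite /ncmul; ring. Qed.

Lemma ncmul_linearl w v u g : klinear (fun f => ncmul w v u f g).
Proof. by move=> c f f'; rewrite /ncmul !mulrDl -!scalerAl. Qed.
Lemma ncmul_linearr w v u f : klinear (ncmul w v u f).
Proof. by move=> c g g'; rewrite /ncmul mulrDr mulrDl -scalerAr -scalerAl. Qed.

End Composition.

(** * Bounded complexes, chains and the differential of transformations *)

Lemma addmxE (R : nmodType) m n (A B : 'M[R]_(m, n)) r c :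
  (A + B) r c = A r c + B r c.
Proof. by rewrite mxE. Qed.
Lemma oppmxE (R : zmodType) m n (A : 'M[R]_(m, n)) r c : (- A) r c = - A r c.
Proof. by rewrite mxE. Qed.
Lemma zeromxE (R : nmodType) m n r c : (0 : 'M[R]_(m, n)) r c = 0.
Proof. by rewrite mxE. Qed.
Lemma scalemxE (R : pzSemiRingType) m n a (A : 'M[R]_(m, n)) r c :
  (a *: A) r c = a * A r c.
Proof. by rewrite mxE. Qed.
Definition linmxE := (addmxE, oppmxE, zeromxE, scalemxE).
(** Settles identities in an additive group of matrices, products of morphisms
    being treated as atoms. *)
Ltac mxring := apply/matrixP=> ? ?; rewrite !linmxE; ring.

Section Complexes.
Variables (k : fieldType) (N : nat).
Local Notation obj := 'I_N.+1.
Local Notation twhom X Y := 'M[{poly k}]_(@tsize k N Y, @tsize k N X).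

Lemma cmulA (x y z w : obj) (f g h : {poly k}) :
  cmul w z x f (cmul z y x g h) = cmul w y x (cmul w z y f g) h.
Proof. exact: ncmulA. Qed.

Lemma cmulDl (z y x : obj) (f f' g : {poly k}) :
  cmul z y x (f + f') g = cmul z y x f g + cmul z y x f' g.
Proof. by rewrite /cmul; ring. Qed.

Lemma cmulDr (z y x : obj) (f g g' : {poly k}) :
  cmul z y x f (g + g') = cmul z y x f g + cmul z y x f g'.
Proof. by rewrite /cmul; ring. Qed.

Lemma cmulZl (z y x : obj) (f g c : {poly k}) :
  cmul z y x (c * f) g = c * cmul z y x f g.
Proof. by rewrite /cmul; ring. Qed.

Lemma cmulZr (z y x : obj) (f g c : {poly k}) :
  cmul z y x f (c * g) = c * cmul z y x f g.
Proof. by rewrite /cmul; ring. Qed.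

Lemma cmul_linearl (z y x : obj) c (a b g : {poly k}) :
  cmul z y x (c *: a + b) g = c *: cmul z y x a g + cmul z y x b g.
Proof. exact: ncmul_linearl. Qed.

Lemma cmul_linearr (z y x : obj) c (a f g : {poly k}) :
  cmul z y x a (c *: f + g) = c *: cmul z y x a f + cmul z y x a g.
Proof. exact: ncmul_linearr. Qed.

Section TwmulTheory.
Variables X Y Z : twobj k N.

Lemma twmulE (f : twhom Y Z) (g : twhom X Y) r c :
  twmul f g r c = \sum_m cmul (tobj r) (tobj m) (tobj c) (f r m) (g m c).
Proof. by rewrite mxE. Qed.

Lemma twmulDl (f f' : twhom Y Z) (g : twhom X Y) :
  twmul (f + f') g = twmul f g + twmul f' g.
Proof.
apply/matrixP=> r c; rewrite !mxE -big_split; apply: eq_bigr => m _.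
by rewrite !mxE cmulDl.
Qed.

Lemma twmulDr (f : twhom Y Z) (g g' : twhom X Y) :
  twmul f (g + g') = twmul f g + twmul f g'.
Proof.
apply/matrixP=> r c; rewrite !mxE -big_split; apply: eq_bigr => m _.
by rewrite !mxE cmulDr.
Qed.

Lemma twmulZl a (f : twhom Y Z) (g : twhom X Y) :
  twmul (a *: f) g = a *: twmul f g.
Proof.
apply/matrixP=> r c; rewrite !mxE mulr_sumr; apply: eq_bigr => m _.
by rewrite !mxE cmulZl.
Qed.

Lemma twmulZr a (f : twhom Y Z) (g : twhom X Y) :
  twmul f (a *: g) = a *: twmul f g.
Proof.
apply/matrixP=> r c; rewrite !mxE mulr_sumr; apply: eq_bigr => m _.
by rewrite !mxE cmulZr.
Qed.

Lemma twmulNl (f : twhom Y Z) (g : twhom X Y) : twmul (- f) g = - twmul f g.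
Proof. by rewrite -scaleN1r twmulZl scaleN1r. Qed.

Lemma twmulNr (f : twhom Y Z) (g : twhom X Y) : twmul f (- g) = - twmul f g.
Proof. by rewrite -scaleN1r twmulZr scaleN1r. Qed.

Lemma twmul0l (g : twhom X Y) : twmul (0 : twhom Y Z) g = 0.
Proof. by rewrite -(scale0r 0) twmulZl scale0r. Qed.

Lemma twmul0r (f : twhom Y Z) : twmul f (0 : twhom X Y) = 0.
Proof. by rewrite -(scale0r 0) twmulZr scale0r. Qed.

Lemma twmulBl (f f' : twhom Y Z) (g : twhom X Y) :
  twmul (f - f') g = twmul f g - twmul f' g.
Proof. by rewrite twmulDl twmulNl. Qed.

Lemma twmulBr (f : twhom Y Z) (g g' : twhom X Y) :
  twmul f (g - g') = twmul f g - twmul f g'.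
Proof. by rewrite twmulDr twmulNr. Qed.

Lemma twhomog0 n : twhomog n (0 : twhom X Y).
Proof. by move=> r c; rewrite mxE eqxx. Qed.

Lemma twhomogD n (f g : twhom X Y) :
  twhomog n f -> twhomog n g -> twhomog n (f + g).
Proof.
move=> hf hg r c; rewrite mxE; case: (eqVneq (f r c) 0) => [->|/hf //].
by rewrite add0r => /hg.
Qed.

Lemma twhomogZ n a (f : twhom X Y) : twhomog n f -> twhomog n (a *: f).
Proof.
move=> hf r c; rewrite mxE; case: (eqVneq (f r c) 0) => [->|/hf //].
by rewrite mulr0 eqxx.
Qed.

Lemma twhomogN n (f : twhom X Y) : twhomog n f -> twhomog n (- f).
Proof. by move=> hf; rewrite -scaleN1r; apply: twhomogZ. Qed.

Lemma twhomogB n (f g : twhom X Y) :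
  twhomog n f -> twhomog n g -> twhomog n (f - g).
Proof. by move=> hf hg; apply: twhomogD => //; apply: twhomogN. Qed.

Lemma twhomogM m n (f : twhom Y Z) (g : twhom X Y) :
  twhomog m f -> twhomog n g -> twhomog (m + n) (twmul f g).
Proof.
move=> hf hg r c; rewrite twmulE => nz.
have [l] : exists l, (f r l != 0) && (g l c != 0).
  apply/existsP; apply: contraR nz; rewrite negb_exists => /forallP nz.
  apply/eqP; apply: big1 => l _; have := nz l.
  by rewrite negb_and !negbK /cmul => /orP[]/eqP->; rewrite ?mulr0 !mul0r.
by case/andP=> /hf-> /hg->; lia.
Qed.

Lemma tdiff_homog : twhomog 1 (tdiff X : twhom X X).
Proof. exact: (@tdiff_deg k N X). Qed.

End TwmulTheory.

Lemma twmulA (X Y Z W : twobj k N)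
    (f : twhom Z W) (g : twhom Y Z) (h : twhom X Y) :
  twmul f (twmul g h) = twmul (twmul f g) h.
Proof.
apply/matrixP=> r c; rewrite !twmulE.
transitivity (\sum_m \sum_n
   cmul (tobj r) (tobj m) (tobj c) (f r m)
     (cmul (tobj m) (tobj n) (tobj c) (g m n) (h n c))).
  by apply: eq_bigr => m _; rewrite twmulE /cmul mulr_sumr mulr_suml.
rewrite exchange_big; apply: eq_bigr => n _.
rewrite twmulE /cmul !mulr_suml; apply: eq_bigr => m _.
exact: cmulA.
Qed.

Lemma const_homog (x y : obj) a :
  @twhomog k N (one k x) (one k y) 0 (const_mx a).
Proof. by []. Qed.

Lemma psignE (n : int) : psign k n = (-1) ^+ `|n|%N.
Proof. by []. Qed.

(** Inverting a chain of length 0 identifies its endpoints, hence the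
    elimination form. *)
Lemma chain0_ind (x : obj) (P : forall z, chain k x 0 z -> Prop) :
  P x (cnil k x) -> forall z (p : chain k x 0 z), P z p.
Proof.
move=> P0 z p.
pose Q d z : chain k x d z -> Prop :=
  match d return chain k x d z -> Prop with
  | 0 => fun p => P z p | _ => fun _ => True end.
suff : Q 0%N z p by [].
by case: p.
Qed.

Lemma chainSP (x z : obj) d (p : chain k x d.+1 z) :
  exists y a (q : chain k x d y), p = ccons z a q.
Proof.
pose Q d z : chain k x d z -> Prop :=
  match d return chain k x d z -> Prop with
  | 0 => fun _ => True
  | d'.+1 => fun p => exists y a (q : chain k x d' y), p = ccons z a q end.
suff : Q d.+1 z p by [].
by case: p => // d' y z' a q; exists y, a, q.
Qed.

Lemma chain1P (x z : obj) (p : chain k x 1 z) :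
  exists a, p = ccons z a (cnil k x).
Proof.
have [y [a [q ->]]] := chainSP p.
by elim/chain0_ind: y / q; exists a.
Qed.

Lemma chain2P (x z : obj) (p : chain k x 2 z) :
  exists y a b, p = ccons z a (ccons y b (cnil k x)).
Proof.
have [y [a [q ->]]] := chainSP p; have [b ->] := chain1P q.
by exists y, a, b.
Qed.

Lemma chain3P (x z : obj) (p : chain k x 3 z) :
  exists l y a b c, p = ccons z a (ccons l b (ccons y c (cnil k x))).
Proof.
have [l [a [q ->]]] := chainSP p; have [y [b [c ->]]] := chain2P q.
by exists l, y, a, b, c.
Qed.

Lemma chain4P (x z : obj) (p : chain k x 4 z) :
  exists m l y a b c e,
    p = ccons z a (ccons m b (ccons l c (ccons y e (cnil k x)))).
Proof.
have [m [a [q ->]]] := chainSP p; have [l [y [b [c [e ->]]]]] := chain3P q.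
by exists m, l, y, a, b, c, e.
Qed.

Section SumSplits.
Variable V : zmodType.

Lemma sum_splits_ind (P : V -> Prop) (x : obj) d (z : obj) (p : chain k x d z)
    (G : forall (y : obj) e m, chain k y e z -> chain k x m y -> V) :
  P 0 -> (forall a b, P a -> P b -> P (a + b)) ->
  (forall y e m q r, (e + m)%N = d -> P (G y e m q r)) -> P (sum_splits p G).
Proof.
move=> P0 PD; elim: p G => //= d' y z' a q IH G PG.
apply: PD; first exact: PG.
by apply: IH => y' e m r s em; apply: PG; rewrite addSn em.
Qed.

Lemma sum_splitsB (x : obj) d (z : obj) (p : chain k x d z) (G G1 G2 :
     forall (y : obj) e m, chain k y e z -> chain k x m y -> V) :
  (forall y e m q r, G y e m q r = G1 y e m q r - G2 y e m q r) ->
  sum_splits p G = sum_splits p G1 - sum_splits p G2.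
Proof.
elim: p G G1 G2 => /= [|d' y z' a q IH] G G1 G2 E; first by rewrite subr0.
rewrite E (IH _ (fun y' e m r => G1 y' e.+1 m (ccons z' a r))
                (fun y' e m r => G2 y' e.+1 m (ccons z' a r))) //.
by rewrite opprD addrACA.
Qed.

Lemma split_first_ind (P : V -> Prop) (x : obj) d (z : obj) (p : chain k x d z)
    (G : forall (y : obj) e, chain k y e z -> {poly k} -> V) :
  P 0 -> (forall y e q a, e.+1 = d -> P (G y e q a)) -> P (split_first p G).
Proof.
move=> P0; elim: p G => //= -[|d'] y z' a q IH G PG; first exact: PG.
by apply: IH => y' e r b ed; apply: PG; rewrite ed.
Qed.

Lemma split_firstB (x : obj) d (z : obj) (p : chain k x d z) (G G1 G2 :
     forall (y : obj) e, chain k y e z -> {poly k} -> V) :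
  (forall y e q a, G y e q a = G1 y e q a - G2 y e q a) ->
  split_first p G = split_first p G1 - split_first p G2.
Proof.
elim: p G G1 G2 => /= [|[|d'] y z' a q IH] G G1 G2 E; rewrite ?subr0 //.
by apply: IH => y' e r b; apply: E.
Qed.

Lemma sum_merges_ind (P : V -> Prop) (x : obj) d (z : obj) (p : chain k x d z)
    (G : nat -> forall e, chain k x e z -> V) :
  P 0 -> (forall a b, P a -> P b -> P (a + b)) ->
  (forall n e q, e.+1 = d -> P (G n e q)) -> P (sum_merges p G).
Proof.
move=> P0 PD; elim: p G => //= d' y z' a q IH G PG.
apply: PD; last by apply: IH => n e r ed; apply: PG; rewrite ed.
by case: q {IH} G PG => // n y' y'' b r G PG; apply: PG.
Qed.

Lemma sum_mergesB (x : obj) d (z : obj) (p : chain k x d z) (G G1 G2 :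
     nat -> forall e, chain k x e z -> V) :
  (forall n e q, G n e q = G1 n e q - G2 n e q) ->
  sum_merges p G = sum_merges p G1 - sum_merges p G2.
Proof.
elim: p G G1 G2 => /= [|d' y z' a q IH] G G1 G2 E; first by rewrite subr0.
rewrite (IH _ (fun n e r => G1 n e.+1 (ccons z' a r))
              (fun n e r => G2 n e.+1 (ccons z' a r))) //.
rewrite opprD addrACA; congr (_ + _).
by case: q {IH} => [|n y' y'' b r]; rewrite ?subr0.
Qed.

End SumSplits.

Section NatMu1.
Variable F : functor_data k N.
(** Since a complex T_x lives in degree 0 and beta T_z in degrees -1 and 0, this
    settles the equation mu^1 = 0 in all but two arities. *)
Lemma nat_mu1_homog g (eta : prenat F) :
  (forall x d z (p : chain k x d z), twhomog (1 - d%:Z) (fmor F p)) ->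
  (forall x d z (p : chain k x d z), twhomog (g - d%:Z) (eta x d z p)) ->
  forall x d z (p : chain k x d z), twhomog (g + 1 - d%:Z) (nat_mu1 g eta p).
Proof.
move=> F_deg He x d z p; rewrite /nat_mu1 /twmu1 /twmu2.
apply: twhomogB; first apply: twhomogD; first apply: twhomogD.
- apply: twhomogB.
    have -> : g + 1 - d%:Z = 1 + (g - d%:Z) by lia.
    by apply: twhomogZ; apply: twhomogM => //; apply: tdiff_homog.
  by rewrite twmul0r; apply: twhomog0.
- apply: sum_splits_ind; [exact: twhomog0 | by move=> *; apply: twhomogD |].
  move=> y e m q r em; apply: twhomogZ.
  have -> : g + 1 - d%:Z = (1 - e%:Z) + (g - m%:Z) by lia.
  exact: twhomogM.
- apply: twhomogZ; apply: split_first_ind; first exact: twhomog0.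
  move=> y e q a ed; apply: twhomogZ.
  have -> : g + 1 - d%:Z = (g - e%:Z) + 0 by lia.
  exact: twhomogM.
- apply: sum_merges_ind; [exact: twhomog0 | by move=> *; apply: twhomogD |].
  move=> n e q ed; apply: twhomogZ.
  by have -> : g + 1 - d%:Z = g - e%:Z by lia.
Qed.

Lemma nat_mu1B g (eta1 eta2 : prenat F) (x : obj) d (z : obj) (p : chain k x d z) :
  nat_mu1 g (fun x d z p => eta1 x d z p - eta2 x d z p) p
  = nat_mu1 g eta1 p - nat_mu1 g eta2 p.
Proof.
rewrite /nat_mu1 /twmu1 /twmu2.
rewrite (@sum_splitsB _ _ _ _ p _ (fun y e m q r =>
      psign k (g - m%:Z) *: @twmul _ _ (one k x) _ _ (fmor F q) (eta1 x m y r))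
   (fun y e m q r =>
      psign k (g - m%:Z) *: @twmul _ _ (one k x) _ _ (fmor F q) (eta2 x m y r)));
  last by move=> *; rewrite twmulBr scalerBr.
rewrite (@split_firstB _ _ _ _ p _ (fun y e q a =>
      psign k 0 *: @twmul _ _ (one k x) (one k y) _ (eta1 y e z q) (const_mx a))
   (fun y e q a =>
      psign k 0 *: @twmul _ _ (one k x) (one k y) _ (eta2 y e z q) (const_mx a)));
  last by move=> *; rewrite twmulBl scalerBr.
rewrite (@sum_mergesB _ _ _ _ p _ (fun n e q => psign k (n%:Z + g - 1) *: eta1 x e z q)
   (fun n e q => psign k (n%:Z + g - 1) *: eta2 x e z q));
  last by move=> *; rewrite scalerBr.
rewrite twmulBr twmulBl !scalerBr.
by mxring.
Qed.

End NatMu1.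

Section LowArity.
Variables (F : functor_data k N) (eta : prenat F).

Local Notation arr z a x := (ccons z a (cnil k x)).
Local Notation "f ** g" := (@twmul _ _ _ _ _ f g) (at level 40).
Local Notation mor x y a := (const_mx a : twhom (one k x) (one k y)).

(** The next four lemmas write out the differential in the arities that matter,
    with the components that vanish for degree reasons removed. *)
Lemma nat_mu1_2_deg1 (z y x : obj) a2 a1 : eta (cnil k x) = 0 ->
  nat_mu1 1 eta (ccons z a2 (arr y a1 x)) =
  - (tdiff _ ** eta (ccons z a2 (arr y a1 x)))
  + fmor F (arr z a2 y) ** eta (arr y a1 x)
  + eta (arr z a2 y) ** mor x y a1
  - eta (arr z (cmul z y x a2 a1) x).
Proof.
move=> eta0; rewrite /nat_mu1 /twmu1 /twmu2 /= eta0 !psignE !twmul0r /=.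
by mxring.
Qed.

Lemma nat_mu1_3_deg1 (z l y x : obj) a3 a2 a1 :
  eta (cnil k x) = 0 -> eta (ccons z a3 (ccons l a2 (arr y a1 x))) = 0 ->
  nat_mu1 1 eta (ccons z a3 (ccons l a2 (arr y a1 x))) =
  - (fmor F (arr z a3 l) ** eta (ccons l a2 (arr y a1 x)))
  + fmor F (ccons z a3 (arr l a2 y)) ** eta (arr y a1 x)
  + eta (ccons z a3 (arr l a2 y)) ** mor x y a1
  + eta (ccons z (cmul z l y a3 a2) (arr y a1 x))
  - eta (ccons z a3 (arr l (cmul l y x a2 a1) x)).
Proof.
move=> eta0 eta3; rewrite /nat_mu1 /twmu1 /twmu2 /= eta0 eta3 !psignE !twmul0r /=.
by mxring.
Qed.

Lemma nat_mu1_3_deg2 (z l y x : obj) a3 a2 a1 :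
  eta (cnil k x) = 0 -> eta (arr y a1 x) = 0 ->
  nat_mu1 2 eta (ccons z a3 (ccons l a2 (arr y a1 x))) =
  - (tdiff _ ** eta (ccons z a3 (ccons l a2 (arr y a1 x))))
  + fmor F (arr z a3 l) ** eta (ccons l a2 (arr y a1 x))
  - eta (ccons z a3 (arr l a2 y)) ** mor x y a1
  - eta (ccons z (cmul z l y a3 a2) (arr y a1 x))
  + eta (ccons z a3 (arr l (cmul l y x a2 a1) x)).
Proof.
move=> eta0 eta1; rewrite /nat_mu1 /twmu1 /twmu2 /= eta0 eta1 !psignE !twmul0r /=.
by mxring.
Qed.

Lemma nat_mu1_4_deg2 (z m l y x : obj) a4 a3 a2 a1 :
  eta (cnil k x) = 0 -> eta (arr y a1 x) = 0 ->
  eta (ccons z a4 (ccons m a3 (ccons l a2 (arr y a1 x)))) = 0 ->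
  nat_mu1 2 eta (ccons z a4 (ccons m a3 (ccons l a2 (arr y a1 x)))) =
  - (fmor F (arr z a4 m) ** eta (ccons m a3 (ccons l a2 (arr y a1 x))))
  + fmor F (ccons z a4 (arr m a3 l)) ** eta (ccons l a2 (arr y a1 x))
  - eta (ccons z a4 (ccons m a3 (arr l a2 y))) ** mor x y a1
  + eta (ccons z (cmul z m l a4 a3) (ccons l a2 (arr y a1 x)))
  - eta (ccons z a4 (ccons m (cmul m l y a3 a2) (arr y a1 x)))
  + eta (ccons z a4 (ccons m a3 (arr l (cmul l y x a2 a1) x))).
Proof.
move=> eta0 eta1 eta4.
rewrite /nat_mu1 /twmu1 /twmu2 /= eta0 eta1 eta4 !psignE !twmul0r /=.
by mxring.
Qed.

End LowArity.

End Complexes.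

(** * The coefficient function is a cocycle *)

Section Coef.
Variables (k : fieldType) (th : nat -> k).

(** The functions [slope] and [drift] are the data of a cochain with poles,
    sending a_{vu} s^b to (slope u * b + drift v u) a_{vu} s^(b-1); its
    coboundary has the coefficient function as coefficient. *)
Definition psum (n : nat) : k := \sum_(0 <= t < n) th t.
Definition slope (v : nat) : k := - (2%:R * psum v + th v).
Definition ppsum (n : nat) : k := \sum_(0 <= e < n) 2%:R * psum e.+1.
Definition drift (v u : nat) : k := ppsum (minn u v) - ppsum u.

Lemma psumS n : psum n.+1 = psum n + th n.
Proof. by rewrite /psum big_nat_recr. Qed.

Lemma ppsumS n : ppsum n.+1 = ppsum n + 2%:R * psum n.+1.
Proof. by rewrite /ppsum big_nat_recr. Qed.

Lemma sum_psum u w : (u <= w)%N -> \sum_(u <= t < w) th t = psum w - psum u.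
Proof.
by move=> uw; rewrite /psum [X in X - _](big_cat_nat _ (n := u)) //= [RHS]addrC addKr.
Qed.

(** The weighted sums of the coefficient function are Abel summations of partial
    sums. *)
Lemma sum_below b u n :
  \sum_(1 <= t < n.+1) (2 * (b + t))%:R * th (u + n - t)%N =
  2%:R * b%:R * (psum (u + n) - psum u) + ppsum (u + n) - ppsum u
  - 2%:R * n%:R * psum u.
Proof.
elim: n u => [|n IH] u; first by rewrite big_geq // addn0; ring.
rewrite big_nat_recr //= -(addSnnS u n) IH addSn -(addnS u n) addnK psumS ppsumS psumS.
by rewrite addnS psumS; ring.
Qed.

Lemma sum_above b v n :
  \sum_(1 <= t < n.+1) (2 * (b + t))%:R * th (v + t)%N =
  2%:R * b%:R * (psum (v + n).+1 - psum v.+1) + 2%:R * n%:R * psum (v + n).+1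
  - (ppsum (v + n) - ppsum v).
Proof.
elim: n => [|n IH]; first by rewrite big_geq // addn0; ring.
by rewrite big_nat_recr //= IH !addnS ppsumS !psumS; ring.
Qed.

(** Each of the six cases of the coefficient function is the same coboundary;
    only the minima in [drift] and the number of dots depend on the order of
    u, v and w. *)
Lemma coef_potential w v b u :
  coef th w v b u = b%:R * (slope v - slope u) + drift v u + drift w v - drift w u
    - slope u * (dots u v w)%:R.
Proof.
rewrite /coef /slope /drift; case: ifP => [/andP[uw wv]|H1].
  have -> : dots u v w = (v - w)%N by rewrite /dots /dist; lia.
  rewrite (minn_idPl (ltnW (leq_trans uw wv))) (minn_idPl (ltnW uw)) (minn_idPr wv).
  rewrite (sum_psum (ltnW uw)).
  have E : v = (w + (v - w))%N by lia.
  move: (v - w)%N E => n -> {wv}; rewrite sum_below; ring.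
case: ifP => [/andP[vw wu]|H2].
  have -> : dots u v w = (w - v)%N by rewrite /dots /dist; lia.
  rewrite (minn_idPr (ltnW (leq_ltn_trans vw wu))) (minn_idPl vw) (minn_idPr (ltnW wu)).
  rewrite (@sum_psum w.+1 u.+1) ?ltnS 1?ltnW //.
  have E : w = (v + (w - v))%N by lia.
  move: (w - v)%N E => n -> {vw wu H1}; rewrite sum_above !psumS; ring.
case: ifP => [/andP[wu uv]|H3].
  have -> : dots u v w = (v - u)%N by rewrite /dots /dist; lia.
  rewrite (minn_idPl (ltnW uv)) (minn_idPr (ltnW (leq_ltn_trans wu uv))) (minn_idPr wu).
  have E : v = (u + (v - u))%N by lia.
  move: (v - u)%N E => n -> {uv H1 H2}; rewrite sum_below; ring.
case: ifP => [/andP[vu uw]|H4].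
  have -> : dots u v w = (u - v)%N by rewrite /dots /dist; lia.
  rewrite (minn_idPr (ltnW vu)) (minn_idPl (ltnW (leq_trans vu uw))) (minn_idPl uw).
  have E : u = (v + (u - v))%N by lia.
  move: (u - v)%N E => n -> {vu uw H1 H2 H3}; rewrite sum_above !psumS; ring.
case: ifP => [/andP[uv vw]|H5].
  have -> : dots u v w = 0%N by rewrite /dots /dist; lia.
  rewrite (minn_idPl (ltnW uv)) (minn_idPl (ltnW vw)) (minn_idPl (ltnW (ltn_trans uv vw))).
  by rewrite (sum_psum (ltnW uv)); ring.
case: ifP => [/andP[wv vu]|H6].
  have -> : dots u v w = 0%N by rewrite /dots /dist; lia.
  rewrite (minn_idPr (ltnW wv)) (minn_idPr (ltnW vu)) (minn_idPr (ltnW (ltn_trans wv vu))).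
  rewrite (@sum_psum v.+1 u.+1) ?ltnS 1?ltnW // !psumS; ring.
have E : u = v by lia.
rewrite E; have -> : dots v v w = 0%N by rewrite /dots /dist; lia.
rewrite minnn; ring.
Qed.

(** A coboundary is a cocycle; [dotsA] makes the terms with dots cancel. *)
Lemma coef_cocycle w v u t c b :
  coef th v u b t - coef th w v c u - coef th w u (c + b + dots u v w) t
  + coef th w v c t = 0.
Proof.
rewrite !coef_potential !natrD.
have := congr1 (fun n => n%:R : k) (dotsA t u v w); rewrite /= !natrD => H.
have -> : (dots t u w)%:R = (dots t v w)%:R + (dots t u v)%:R - (dots u v w)%:R :> k.
  by rewrite H addrC addKr.
ring.
Qed.

(** No pole occurs: without any dot the path is monotone and the drift is
    additive along it, so that a truncated exponent always comes with a
    coefficient 0. *)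
Lemma coef_exp0 w v u b a : (b + a + dots u v w = 0)%N -> coef th w v b u = 0.
Proof.
move=> H; have -> : b = 0%N by lia.
have d0 : dots u v w = 0%N by lia.
rewrite coef_potential d0 /drift; move: d0; rewrite /dots /dist => d0.
case: (leqP u v) => uv.
- have vw : (u = v \/ v <= w)%N by lia.
  case: vw => vw; first by rewrite vw ?minnn; ring.
  by rewrite ?(minn_idPl uv) ?(minn_idPl vw) ?(minn_idPl (leq_trans uv vw)); ring.
- have wv : (w <= v)%N by lia.
  by rewrite ?(minn_idPr (ltnW uv)) ?(minn_idPr wv) ?(minn_idPr (ltnW (leq_ltn_trans wv uv))); ring.
Qed.

(** The same at the vertex i, where the values have to lie in the ideal and the
    exponent loses one more unit; this is where theta_i = 0 is used. *)
Lemma coef_loop w v b a :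
  th w = 0 -> (b + a + dist w v <= 1)%N -> coef th w v b w = 0.
Proof.
move=> tw H; rewrite coef_potential /drift minnn.
case: (ltngtP v w) => vw.
- have -> : b = 0%N by rewrite /dist in H; lia.
  have -> : dots w v w = 1%N by rewrite /dots /dist in H *; lia.
  have -> : w = v.+1 by rewrite /dist in H; lia.
  have tv : th v.+1 = 0 by rewrite -tw; congr th; rewrite /dist in H; lia.
  by rewrite ppsumS /slope tv; ring.
- have -> : b = 0%N by rewrite /dist in H; lia.
  have -> : dots w v w = 1%N by rewrite /dots /dist in H *; lia.
  have -> : v = w.+1 by rewrite /dist in H; lia.
  by rewrite ppsumS /slope psumS tw; ring.
- rewrite vw ?minnn; have -> : dots w w w = 0%N by rewrite /dots /dist; lia.
  ring.
Qed.

Lemma coef_up v : coef th v v.+1 0 v = - th v.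
Proof.
rewrite coef_potential /drift minnn.
have -> : dots v v.+1 v = 1%N by rewrite /dots /dist; lia.
have -> : minn v v.+1 = v by lia.
have -> : minn v.+1 v = v by lia.
by rewrite ppsumS /slope psumS; ring.
Qed.

Lemma coef_down v : coef th v.+1 v 0 v.+1 = th v.+1.
Proof.
rewrite coef_potential /drift minnn.
have -> : dots v.+1 v v.+1 = 1%N by rewrite /dots /dist; lia.
have -> : minn v v.+1 = v by lia.
have -> : minn v.+1 v = v by lia.
by rewrite ppsumS /slope; ring.
Qed.

Definition coef_cochain (w v u : nat) (f g : {poly k}) : {poly k} :=
  lin_of (fun b => lin_of (fun a =>
    coef th w v b u *: 'X^(b + a + dots u v w - 1)) g) f.

Lemma coef_cochain_linl w v u g : klinear (fun f => coef_cochain w v u f g).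
Proof. exact: lin_of_klinear. Qed.

Lemma coef_cochain_linr w v u f : klinear (coef_cochain w v u f).
Proof.
exact: lin_of_param (fun b => lin_of_klinear _).
Qed.

Lemma coef_cochainX w v u b a :
  coef_cochain w v u 'X^b 'X^a = coef th w v b u *: 'X^(b + a + dots u v w - 1).
Proof. by rewrite /coef_cochain !lin_ofX. Qed.

(** Multiplication by a power of s is compatible with the truncated exponent,
    by [coef_exp0]. *)
Lemma coef_shift w v u b a r :
  coef th w v b u *: 'X^(b + a + dots u v w - 1) * 'X^r
  = coef th w v b u *: 'X^(b + a + dots u v w + r - 1).
Proof.
case: (posnP (b + a + dots u v w)) => H; first by rewrite (coef_exp0 H) !scale0r mul0r.
by rewrite -scalerAl -exprD; congr (_ *: 'X^_); lia.
Qed.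

Lemma coef_cochain_cocycle w v u t a3 a2 a1 :
  ncmul w v t a3 (coef_cochain v u t a2 a1) - ncmul w u t (coef_cochain w v u a3 a2) a1
  - coef_cochain w u t (ncmul w v u a3 a2) a1 + coef_cochain w v t a3 (ncmul v u t a2 a1) = 0.
Proof.
pose F a3 a2 a1 := ncmul w v t a3 (coef_cochain v u t a2 a1) - ncmul w u t (coef_cochain w v u a3 a2) a1
  - coef_cochain w u t (ncmul w v u a3 a2) a1 + coef_cochain w v t a3 (ncmul v u t a2 a1).
rewrite -/(F a3 a2 a1).
have l0 : klinear (fun _ : {poly k} => 0 : {poly k}).
  by move=> *; rewrite scaler0 addr0.
have l3 x y : klinear (fun f => F f x y).
  move=> c f g; rewrite /F ncmul_linearl coef_cochain_linl ncmul_linearl ncmul_linearl !coef_cochain_linl.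
  by rewrite !(scalerDr, scalerN); ring.
have l2 x y : klinear (fun f => F x f y).
  move=> c f g; rewrite /F coef_cochain_linl ncmul_linearr coef_cochain_linr ncmul_linearl ncmul_linearr coef_cochain_linl.
  by rewrite ncmul_linearl coef_cochain_linr !(scalerDr, scalerN); ring.
have l1 x y : klinear (F x y).
  move=> c f g; rewrite /F coef_cochain_linr !ncmul_linearr !coef_cochain_linr !(scalerDr, scalerN); ring.
apply: (klinear_ext (l3 _ _) l0) => n3 {a3}.
apply: (klinear_ext (l2 _ _) l0) => n2 {a2}.
apply: (klinear_ext (l1 _ _) l0) => n1 {a1}.
rewrite /F [ncmul w v u 'X^n3 'X^n2]/ncmul [ncmul v u t 'X^n2 'X^n1]/ncmul -!exprD !coef_cochainX.
have -> : ncmul w v t 'X^n3 (coef th v u n2 t *: 'X^(n2 + n1 + dots t u v - 1))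
        = coef th v u n2 t *: 'X^(n2 + n1 + dots t u v - 1) * 'X^(n3 + dots t v w).
  by rewrite exprD /ncmul; ring.
have -> : ncmul w u t (coef th w v n3 u *: 'X^(n3 + n2 + dots u v w - 1)) 'X^n1
        = coef th w v n3 u *: 'X^(n3 + n2 + dots u v w - 1) * 'X^(n1 + dots t u w).
  by rewrite exprD /ncmul; ring.
rewrite !coef_shift; set M := (n3 + n2 + n1 + dots t u v + dots t v w - 1)%N.
have D := dotsA t u v w.
have -> : (n2 + n1 + dots t u v + (n3 + dots t v w) - 1 = M)%N by rewrite /M; lia.
have -> : (n3 + n2 + dots u v w + (n1 + dots t u w) - 1 = M)%N by rewrite /M; lia.
have -> : (n3 + n2 + dots u v w + n1 + dots t u w - 1 = M)%N by rewrite /M; lia.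
have -> : (n3 + (n2 + n1 + dots t u v) + dots t v w - 1 = M)%N by rewrite /M; lia.
by rewrite -!scalerBl -scalerDl coef_cocycle scale0r.
Qed.

Lemma coef_cochain_ideal i v f g : th i = 0 -> (coef_cochain i v i f g)`_0 = 0.
Proof.
move=> ti; rewrite /coef_cochain /lin_of coef_sum big1 // => b _; rewrite coefZ coef_sum.
rewrite big1 ?mulr0 // => a _; rewrite !coefZ coefXn.
case: eqP => [H|_]; rewrite ?mulr0 // (@coef_loop i v b a) ?mul0r ?mulr0 //.
by move: H; rewrite /dots /dist; lia.
Qed.

End Coef.

Lemma coef_linear (k : fieldType) (t t1 t2 : nat -> k) c w v b u :
  (forall j, t j = c * t1 j + t2 j) ->
  coef t w v b u = c * coef t1 w v b u + coef t2 w v b u.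
Proof.
move=> tE; rewrite !coef_potential /slope /drift.
have psE n : psum t n = c * psum t1 n + psum t2 n.
  by rewrite /psum mulr_sumr -big_split; apply: eq_bigr => j _.
have ppsE n : ppsum t n = c * ppsum t1 n + ppsum t2 n.
  rewrite /ppsum mulr_sumr -big_split; apply: eq_bigr => j _.
  by rewrite psE /=; ring.
by rewrite !psE !ppsE !tE; ring.
Qed.

(** * Primitives of 2-cocycles *)

Section Vanishing.
Variables (k : fieldType) (N i : nat).
Hypothesis N0 : (0 < N)%N.
Variable phi : nat -> nat -> nat -> {poly k} -> {poly k} -> {poly k}.

Hypothesis phi_linl : forall w v u g, (w <= N)%N -> (v <= N)%N -> (u <= N)%N ->
  klinear (fun f => phi w v u f g).
Hypothesis phi_linr : forall w v u f, (w <= N)%N -> (v <= N)%N -> (u <= N)%N ->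
  klinear (phi w v u f).
Hypothesis phi_cocycle : forall w v u t a3 a2 a1,
  (w <= N)%N -> (v <= N)%N -> (u <= N)%N -> (t <= N)%N ->
  ncmul w v t a3 (phi v u t a2 a1) - ncmul w u t (phi w v u a3 a2) a1
  - phi w u t (ncmul w v u a3 a2) a1 + phi w v t a3 (ncmul v u t a2 a1) = 0.
Hypothesis phi_ideal : forall v f g, (i <= N)%N -> (v <= N)%N -> (phi i v i f g)`_0 = 0.
Hypothesis phi_obs : forall v, (0 < v < N)%N ->
  (phi v v.-1 v 1 1 - phi v v.+1 v 1 1)`_0 = 0.

Local Notation extension := ({poly k} * {poly k})%type.

(** Composition in the square-zero extension of the category defined by phi: a
    linear splitting is a functor exactly when its second component is a
    primitive of phi. *)
Definition ext_mul (w v u : nat) (x y : extension) : extension :=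
  (ncmul w v u x.1 y.1, ncmul w v u x.1 y.2 + ncmul w v u x.2 y.1 - phi w v u x.1 y.1).

(** Associativity of the extension is the cocycle identity. *)
Lemma ext_mulA w v u t x y z :
  (w <= N)%N -> (v <= N)%N -> (u <= N)%N -> (t <= N)%N ->
  ext_mul w v t x (ext_mul v u t y z) = ext_mul w u t (ext_mul w v u x y) z.
Proof.
move=> hw hv hu ht; rewrite /ext_mul /= ncmulA; congr (_, _).
have /eqP := phi_cocycle x.1 y.1 z.1 hw hv hu ht.
rewrite !ncmulDr !ncmulDl !ncmulNl !ncmulNr !ncmulA => /eqP H.
by rewrite -[LHS]addr0 -H; ring.
Qed.

Definition ext_unit (v : nat) : extension := (1, phi v v v 1 1).

Lemma ext_mul1l v u y :
  (v <= N)%N -> (u <= N)%N -> ext_mul v v u (ext_unit v) y = y.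
Proof.
move=> hv hu; case: y => f g; rewrite /ext_mul /ext_unit /=.
have := phi_cocycle 1 1 f hv hv hv hu.
rewrite /ncmul !dots_end !expr0 !(mul1r, mulr1) addrAC addrK => /eqP.
by rewrite subr_eq0 => /eqP->; rewrite addrK.
Qed.

(** The correction of the lift of p_v.  With q_v lifted by (1, 0), the relations
    determine it vertex by vertex; the division by s is possible because the
    constant terms vanish.  The value at v = 1 is arbitrary. *)
Fixpoint defect (v : nat) : {poly k} :=
  if v is v'.+1 then
    defect v' - drop_poly 1 (phi v' v'.-1 v' 1 1 - phi v' v'.+1 v' 1 1)
  else 0.

Definition lift_p v : extension := (1, defect v).
Definition lift_q (v : nat) : extension := (1, 0).

(** The lifted arrows satisfy the defining relations of the category. *)
Lemma lift_relation v : (0 < v < N)%N ->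
  ext_mul v v.-1 v (lift_p v) (lift_q v.-1) = ext_mul v v.+1 v (lift_q v) (lift_p v.+1).
Proof.
move=> hv; rewrite /ext_mul /=.
set d := phi v v.-1 v 1 1; set d' := phi v v.+1 v 1 1.
have dd : d - d' = drop_poly 1 (d - d') * 'X.
  rewrite -[LHS](poly_take_drop 1) expr1 [take_poly 1 _](_ : _ = 0) ?add0r //.
  by apply/polyP => -[|n]; rewrite coef_take_poly coef0 ?phi_obs.
have e1 : dots v v.-1 v = 1%N by rewrite /dots /dist; lia.
have e2 : dots v v.+1 v = 1%N by rewrite /dots /dist; lia.
rewrite /ncmul e1 e2 expr1; congr (_, _).
rewrite /= -/d -/d'; move: (drop_poly 1 _) dd => q dd.
have -> : d = d' + q * 'X by rewrite -dd addrC subrK.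
by ring.
Qed.

(** The lift of s at the vertex v.  The two expressions agree at interior
    vertices; at each end only one of them makes sense. *)
Definition lift_s v : extension :=
  if (v < N)%N then ext_mul v v.+1 v (lift_q v) (lift_p v.+1)
  else ext_mul v v.-1 v (lift_p v) (lift_q v.-1).

Lemma lift_s_qp v :
  (v < N)%N -> lift_s v = ext_mul v v.+1 v (lift_q v) (lift_p v.+1).
Proof. by rewrite /lift_s => ->. Qed.

Lemma lift_s_pq v :
  (0 < v <= N)%N -> lift_s v = ext_mul v v.-1 v (lift_p v) (lift_q v.-1).
Proof.
rewrite /lift_s => hv; case: ltnP => // vN.
by rewrite lift_relation //; case/andP: hv => ->.
Qed.

(** Lifts of the shortest paths starting at u, of length n, to the right and to
    the left. *)
Fixpoint ascent (u n : nat) : extension :=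
  if n is n'.+1 then ext_mul (u + n) (u + n') u (lift_p (u + n)) (ascent u n')
  else ext_unit u.

Fixpoint descent (u n : nat) : extension :=
  if n is n'.+1 then ext_mul (u - n) (u - n') u (lift_q (u - n)) (descent u n')
  else ext_unit u.

Definition word (v u : nat) : extension :=
  if (u <= v)%N then ascent u (v - u) else descent u (u - v).

Lemma word_up v u :
  (u <= v)%N -> word v.+1 u = ext_mul v.+1 v u (lift_p v.+1) (word v u).
Proof.
move=> uv; rewrite /word uv (leq_trans uv) // subSn //=.
by rewrite addnS subnKC.
Qed.

Lemma word_down v u :
  (v < u)%N -> word v u = ext_mul v v.+1 u (lift_q v) (word v.+1 u).
Proof.
move=> vu; rewrite /word leqNgt vu /= -(subnSK vu) /=.
have -> : (u - (u - v.+1).+1)%N = v by lia.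
have -> : (u - (u - v.+1))%N = v.+1 by lia.
case: leqP => [uv|//].
have -> : u = v.+1 by lia.
by rewrite subnn.
Qed.

(** The lift of a_{vu} s^n: a shortest path followed by n loops. *)
Definition basis_lift n (v u : nat) : extension :=
  iter n (ext_mul v v u (lift_s v)) (word v u).

Lemma basis_liftS n v u :
  basis_lift n.+1 v u = ext_mul v v u (lift_s v) (basis_lift n v u).
Proof. by []. Qed.

(** Moving the arrow through the loops uses that the lifts of s commute with the
    lifted arrows; if the path came from the right, the arrow creates a loop. *)
Lemma p_basis_lift n v u : (v < N)%N -> (u <= N)%N ->
  ext_mul v.+1 v u (lift_p v.+1) (basis_lift n v u) = basis_lift (n + (v < u)) v.+1 u.
Proof.
move=> vN uN; elim: n => [|n IH].
  case: ltnP => [vu|uv]; rewrite /basis_lift /=; last by rewrite word_up.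
  rewrite word_down // ext_mulA //; try lia.
  by rewrite lift_s_pq.
rewrite basis_liftS ext_mulA //; try lia.
rewrite addSn basis_liftS -IH ext_mulA //; try lia.
congr (ext_mul _ _ _ _ _).
rewrite lift_s_qp // ext_mulA //; try lia.
by rewrite lift_s_pq.
Qed.

Lemma q_basis_lift n v u : (v < N)%N -> (u <= N)%N ->
  ext_mul v v.+1 u (lift_q v) (basis_lift n v.+1 u) = basis_lift (n + (u <= v)) v u.
Proof.
move=> vN uN; elim: n => [|n IH].
  case: leqP => [uv|vu]; rewrite /basis_lift /=; last by rewrite (word_down vu).
  rewrite word_up // ext_mulA //; try lia.
  by rewrite lift_s_qp.
rewrite basis_liftS ext_mulA //; try lia.
rewrite addSn basis_liftS -IH ext_mulA //; try lia.
congr (ext_mul _ _ _ _ _).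
rewrite lift_s_pq // ext_mulA //; try lia.
by rewrite lift_s_qp.
Qed.

Lemma word_basis_lift n w v u : (w <= N)%N -> (v <= N)%N -> (u <= N)%N ->
  ext_mul w v u (word w v) (basis_lift n v u) = basis_lift (n + dots u v w) w u.
Proof.
move=> hw hv hu; rewrite /word; case: leqP => vw.
  have : (v + (w - v) <= N)%N by lia.
  rewrite -{2 4 5}(subnKC vw); elim: (w - v)%N => [|m IH] hm.
    by rewrite /= addn0 ext_mul1l // dots_end addn0.
  rewrite /= -ext_mulA ?IH ?addnS ?p_basis_lift; try lia.
  congr (basis_lift _ _ _); move: (dots2 u v (v + m)) (dots2 u v (v + m).+1).
  by rewrite /dist; lia.
have : (w = v - (v - w))%N by lia.
move=> {1 3 4}->; elim: (v - w)%N (leq_subr w v) => [|m IH] hm.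
  by rewrite /= subn0 ext_mul1l // dots_end addn0.
have mv : (v - m = (v - m.+1).+1)%N by lia.
rewrite /= -ext_mulA ?IH; try lia.
rewrite [in LHS]mv q_basis_lift; try lia.
rewrite -mv; congr (basis_lift _ _ _); move: (dots2 u v (v - m)) (dots2 u v (v - m.+1)).
by rewrite /dist; lia.
Qed.

(** The lift is a functor: words in the arrows act on lifted basis elements as
    they do in the category. *)
Lemma basis_lift_mul m n w v u : (w <= N)%N -> (v <= N)%N -> (u <= N)%N ->
  ext_mul w v u (basis_lift m w v) (basis_lift n v u) = basis_lift (m + n + dots u v w) w u.
Proof.
move=> hw hv hu; elim: m => [|m IH]; first by rewrite add0n word_basis_lift.
by rewrite basis_liftS -(ext_mulA _ _ _ hw hw hv hu) IH !addSn basis_liftS.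
Qed.

Lemma basis_lift_fst n v u :
  (v <= N)%N -> (u <= N)%N -> (basis_lift n v u).1 = 'X^n.
Proof.
move=> hv hu; elim: n => [|n IH]; last first.
  rewrite basis_liftS /= IH /ncmul /lift_s dots_end exprS expr0 mulr1.
  case: ltnP => vN /=; rewrite /ncmul !mul1r.
    have -> : dots v v.+1 v = 1%N by rewrite /dots /dist; lia.
    by rewrite expr1.
  have -> : dots v v.-1 v = 1%N by rewrite /dots /dist; lia.
  by rewrite expr1.
rewrite /basis_lift /= /word; case: leqP => uv.
  elim: (v - u)%N => [|m IH]; first by rewrite expr0.
  rewrite [LHS]/= IH /ncmul !mul1r.
  have -> : dots u (u + m) (u + m.+1) = 0%N by rewrite /dots /dist; lia.
  by [].
have : (u - v <= u)%N by lia.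
elim: (u - v)%N => [|m IH] mu; first by rewrite expr0.
rewrite [LHS]/= IH 1?ltnW // /ncmul !mul1r.
have -> : dots u (u - m) (u - m.+1) = 0%N by rewrite /dots /dist; lia.
by [].
Qed.

(** The extension of the category by the ideal I only. *)
Definition in_ideal (v u : nat) (x : extension) := v = i -> u = i -> x.2`_0 = 0.

Lemma ext_mul_ideal w v u x y : (w <= N)%N -> (v <= N)%N -> (u <= N)%N ->
  in_ideal w v x -> in_ideal v u y -> in_ideal w u (ext_mul w v u x y).
Proof.
move=> hw hv hu hx hy wi ui; rewrite /ext_mul /=.
have hi : (i <= N)%N by rewrite -wi.
rewrite coefB coefD [(phi _ _ _ _ _)`_0](_ : _ = 0); last first.
  by rewrite wi ui phi_ideal.
rewrite subr0 /ncmul; case: (eqVneq v i) => [vi|vi].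
  by rewrite !coef0M hx // hy // !(mulr0, mul0r) addr0.
have -> : dots u v w = (dots u v w).-1.+1.
  by move: vi; rewrite wi ui /dots /dist; lia.
by rewrite exprSr !mulrA !coefMX addr0.
Qed.

Lemma basis_lift_ideal n v u :
  (v <= N)%N -> (u <= N)%N -> in_ideal v u (basis_lift n v u).
Proof.
move=> hv hu.
have hU w : (w <= N)%N -> in_ideal w w (ext_unit w) by move=> hw wi _; rewrite /= wi phi_ideal // -wi.
have hP w w' : (w != w') -> in_ideal w w' (lift_p w) by move=> ww' wi w'i; rewrite wi w'i eqxx in ww'.
have hQ w w' : (w != w') -> in_ideal w w' (lift_q w) by move=> ww' wi w'i; rewrite wi w'i eqxx in ww'.
elim: n => [|n IH]; last first.
  rewrite basis_liftS; apply: ext_mul_ideal => //.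
  by rewrite /lift_s; case: ltnP => vN; apply: ext_mul_ideal; (lia || (apply: hP; lia) || (apply: hQ; lia)).
rewrite /basis_lift /= /word; case: leqP => uv.
  have : (u + (v - u) <= N)%N by lia.
  rewrite -{2}(subnKC uv); elim: (v - u)%N => [|m IH] hm /=; first by rewrite addn0; apply: hU.
  by apply: ext_mul_ideal; try lia; [apply: hP; lia | apply: IH; lia].
have : (u - v <= u)%N by lia.
have {2}-> : (v = u - (u - v))%N by lia.
elim: (u - v)%N => [|m IH] mu /=; first by rewrite subn0; apply: hU.
by apply: ext_mul_ideal; try lia; [apply: hQ; lia | apply: IH; lia].
Qed.

Definition splitting (v u : nat) : {poly k} -> {poly k} :=
  lin_of (fun n => (basis_lift n v u).2).

(** The primitive takes its values in the ideal, as the lift never leaves the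
    extension by I. *)
Lemma splitting_ideal f : (i <= N)%N -> (splitting i i f)`_0 = 0.
Proof.
move=> hi; rewrite /splitting /lin_of coef_sum big1 // => a _.
by rewrite coefZ basis_lift_ideal ?mulr0.
Qed.

Lemma splittingP w v u f g : (w <= N)%N -> (v <= N)%N -> (u <= N)%N ->
  ncmul w v u f (splitting v u g) + ncmul w v u (splitting w v f) g
  - splitting w u (ncmul w v u f g) = phi w v u f g.
Proof.
move=> hw hv hu.
have lS w' v' := lin_of_klinear (fun n => (basis_lift n w' v').2).
pose F f g := ncmul w v u f (splitting v u g) + ncmul w v u (splitting w v f) g
  - splitting w u (ncmul w v u f g).
rewrite -/(F f g).
have lFl g' : klinear (F^~ g').
  move=> c f1 f2; rewrite /F /splitting ncmul_linearl lS ncmul_linearl ncmul_linearl lS.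
  by rewrite !scalerDr scalerN; ring.
have lFr f' : klinear (F f').
  move=> c f1 f2; rewrite /F /splitting ncmul_linearr lS ncmul_linearr ncmul_linearr lS.
  by rewrite !scalerDr scalerN; ring.
apply: (klinear_ext (lFl g) (phi_linl g hw hv hu)) => m {f}.
apply: (klinear_ext (lFr 'X^m) (phi_linr 'X^m hw hv hu)) => n {g}.
have := congr1 snd (basis_lift_mul m n hw hv hu).
rewrite /F /splitting /ext_mul /= !basis_lift_fst // => E.
rewrite {3}/ncmul -!exprD !lin_ofX -E; ring.
Qed.

End Vanishing.

(** * The braiding functor *)

Lemma neq_cases (a b : nat) : a <> b -> (a < b)%N \/ (b < a)%N.
Proof. by lia. Qed.

(** The next three lemmas count the dots of composites through a neighbour of i,
    according to the side of i on which the source lies. *)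
Lemma dots_lt (x i : nat) : (x < i)%N ->
  (dots x i.-1 i = 0%N) * (dots x i.+1 i = 1%N) *
  (dots x i i.-1 = 1%N) * (dots x i i.+1 = 0%N).
Proof. by move=> xi; do !split; rewrite /dots /dist; lia. Qed.

Lemma dots_gt (x i : nat) : (0 < i < x)%N ->
  (dots x i.-1 i = 1%N) * (dots x i.+1 i = 0%N) *
  (dots x i i.-1 = 0%N) * (dots x i i.+1 = 1%N).
Proof. by move=> xi; do !split; rewrite /dots /dist; lia. Qed.

Lemma dots_eq (i : nat) : (0 < i)%N ->
  (dots i i.-1 i = 1%N) * (dots i i.+1 i = 1%N) *
  (dots i i i.-1 = 0%N) * (dots i i i.+1 = 0%N).
Proof. by move=> xi; do !split; rewrite /dots /dist; lia. Qed.

Section Braiding.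
Variables (k : fieldType) (N i : nat).
Local Notation obj := 'I_N.+1.
Local Notation twhom X Y := 'M[{poly k}]_(@tsize k N Y, @tsize k N X).
Local Notation B := (beta k N i).
Local Notation arr z a x := (ccons z a (cnil k x)).
Local Notation "f ** g" := (@twmul _ _ _ _ _ f g) (at level 40).
Local Notation mor x y a := (const_mx a : twhom (one k x) (one k y)).
Local Notation bhom x z := (twhom (one k x) (beta_obj k i z)).

Lemma mulXl (f g : {poly k}) n : f * 'X * g * 'X^n = f * g * 'X^(n.+1).
Proof. by rewrite exprS; ring. Qed.
Lemma mulXr (f g : {poly k}) n : f * (g * 'X) * 'X^n = f * g * 'X^(n.+1).
Proof. by rewrite exprS; ring. Qed.
Lemma mulXX (f g : {poly k}) m n : f * g * 'X^m * 'X^n = f * g * 'X^(m + n).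
Proof. by rewrite exprD mulrA. Qed.
Lemma mulXn (f g : {poly k}) n : f * g * 'X^n * 'X = f * g * 'X^(n.+1).
Proof. by rewrite exprSr mulrA. Qed.
Definition mulXE := (mulXl, mulXr, mulXX, mulXn).

Lemma side_lt (y : nat) : (y < i)%N -> side (y%:Z - i%:Z) = 1%N.
Proof.
by rewrite /side => yi; have /negbTE-> : ~~ (0 < y%:Z - i%:Z) by lia.
Qed.
Lemma side_gt (y : nat) : (i < y)%N -> side (y%:Z - i%:Z) = 2.
Proof. by rewrite /side => yi; have -> : (0 < y%:Z - i%:Z) by lia. Qed.
Lemma side_lt' (y : nat) : (y < i)%N -> side (i%:Z - y%:Z) = 2.
Proof. by rewrite /side => yi; have -> : (0 < i%:Z - y%:Z) by lia. Qed.
Lemma side_gt' (y : nat) : (i < y)%N -> side (i%:Z - y%:Z) = 1%N.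
Proof.
by rewrite /side => yi; have /negbTE-> : ~~ (0 < i%:Z - y%:Z) by lia.
Qed.
Lemma sgz_lt (y : nat) : (y < i)%N -> sgz (i%:Z - y%:Z) = 1.
Proof. by move=> yi; rewrite gtr0_sgz //; lia. Qed.
Lemma sgz_gt (y : nat) : (i < y)%N -> sgz (i%:Z - y%:Z) = -1.
Proof. by move=> yi; rewrite ltr0_sgz //; lia. Qed.

Local Notation sg n := ((sgz (n%:Z - i%:Z))%:~R : k).

Lemma sg_lt (n : nat) : (n < i)%N -> sg n = -1.
Proof. by move=> ni; rewrite ltr0_sgz ?rmorphN //; lia. Qed.
Lemma sg_gt (n : nat) : (i < n)%N -> sg n = 1.
Proof. by move=> ni; rewrite gtr0_sgz //; lia. Qed.
Lemma sg_eq : sg i = 0.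
Proof. by rewrite subrr sgz0. Qed.

Hypothesis hi : (0 < i < N)%N.
Hypothesis k2 : (2%:R : k) != 0.

Let i_gt0 : (0 < i)%N. Proof. by case/andP: hi. Qed.

Lemma inord_i : @inord N i = i :> nat.
Proof. by rewrite inordK //; move: hi; lia. Qed.
Lemma inord_pi : @inord N i.-1 = i.-1 :> nat.
Proof. by rewrite inordK //; move: hi; lia. Qed.
Lemma inord_si : @inord N i.+1 = i.+1 :> nat.
Proof. by rewrite inordK //; move: hi; lia. Qed.
Definition inordE := (inord_i, inord_pi, inord_si).

Lemma beta_mor_homog x d z (p : chain k x d z) :
  twhomog (1 - d%:Z) (fmor B p).
Proof.
move=> r c; rewrite /= mxE; case: p r c => /= [|d' y' z' a q] r c; first by rewrite ?eqxx.
case: q => /= [|d'' y'' z'' b s].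
- rewrite /beta1; move: r c; rewrite /beta_obj.
  case: ifP => zi; case: ifP => xi r c; rewrite ?(addr0, subrr) //=.
  + case: (eqVneq (r : nat) c) => [rc _|_]; last by rewrite ?eqxx.
    by have -> : r = c by [apply: val_inj].
  + rewrite /cone_deg /side.
    by case: r => [[|[|[|r]]] hr] //=; case: (0 < _)%R; rewrite ?eqxx.
  + rewrite /cone_deg.
    by case: c => [[|[|[|c]]] hc] //=; rewrite ?eqxx.
- case: s => [|? ? ? ? ?] /=; last by rewrite eqxx.
  rewrite /beta2; move: r c; rewrite /beta_obj.
  case: ifP => zi; case: ifP => xi r c /=; rewrite ?eqxx //=.
  + rewrite /cone_deg /side.
    by case: (0 < i%:Z - z''%:Z)%R; case: r c => [[|r] hr] [[|c] hc] /=; rewrite ?eqxx.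
  + by rewrite /cone_deg; case: r => [[|r] hr] /=; rewrite ?eqxx.
Qed.

(** The components of the functor as plain matrices, free of chains. *)
Definition beta_mx1 (z y : obj) a : twhom (beta_obj k i y) (beta_obj k i z) :=
  \matrix_(r, c) beta1 i y z a r c.

Definition beta_mx2 (z y x : obj) a2 a1 : twhom (beta_obj k i x) (beta_obj k i z) :=
  \matrix_(r, c) beta2 i x y z a2 a1 r c.

Lemma beta_mor1 (z y : obj) a : fmor B (arr z a y) = beta_mx1 z y a.
Proof. by []. Qed.

Lemma beta_mor2 (z y x : obj) a2 a1 :
  fmor B (ccons z a2 (arr y a1 x)) = beta_mx2 z y x a2 a1.
Proof. by []. Qed.

Lemma beta_mx1_homog (z y : obj) a : twhomog 0 (beta_mx1 z y a).
Proof. exact: (beta_mor_homog (p := arr z a y)). Qed.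

(** The functor equation in arity one. *)
Lemma beta_mx1_chain (z y : obj) a :
  tdiff _ ** beta_mx1 z y a = beta_mx1 z y a ** tdiff _.
Proof.
apply/matrixP => r c; rewrite [LHS]twmulE [RHS]twmulE.
under eq_bigr => m _ do rewrite mxE.
under [RHS]eq_bigr => m _ do rewrite mxE.
move: r c; rewrite /beta1 /beta_obj.
case: eqP => zi; case: eqP => yi r c /=; rewrite ?big_ord_recl ?big_ord0 /cmul /=;
rewrite ?mxE /= ?(mul0r, mulr0, addr0, add0r) //.
- case: r c => [[|[|[|r]]] hr] [[|[|[|c]]] hc] //=;
    rewrite /bump /= ?(mul0r, mulr0, addr0, add0r) ?mul1r ?mulr1 //;
    rewrite ?mulN1r ?mulrN1; do ?congr (- _); congr (_ * 'X^_);
    rewrite /cone_obj /= !inordE /dots /dist; lia.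
- by rewrite /side; case: (0 < _)%R; rewrite mulr0 mul0r.
- case: c => [[|[|[|c]]] hc] //=; rewrite ?(mul0r, mulr0, addr0) // mulr1.
  rewrite mulrN1 mulNr; apply/esym/eqP; rewrite subr_eq0; apply/eqP.
  rewrite /cone_obj /= !inordE; case: ltnP => iz.
    have -> : dots i i.-1 z = (dots i i.+1 z).+1.
      by rewrite /dots /dist; move: hi; lia.
    by rewrite exprS; ring.
  have -> : dots i i.+1 z = (dots i i.-1 z).+1.
    by move/eqP: zi; rewrite /dots /dist /=; move: hi; lia.
  by rewrite exprS; ring.
Qed.

(** The map (p_i, q_i) from beta T_i to T_i, and the identity of T_z for z <> i. *)
Definition pi_mx (z : obj) : twhom (beta_obj k i z) (one k z) :=
  \matrix_(r, c) if (val z == i) && (val c == 0%N) then 0 else 1.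

(** The two composites p_i q_{i-1} and q_i p_{i+1} agree. *)
Lemma pi_mx_diff z : pi_mx z ** tdiff (beta_obj k i z) = 0.
Proof.
apply/matrixP => r c; rewrite !twmulE mxE; move: r c; rewrite /pi_mx /beta_obj.
case: eqP => zi r c /=; rewrite ?big_ord_recl ?big_ord0 /cmul !mxE /=; last first.
  by rewrite mulr0 mul0r addr0.
case: c => [[|[|[|c]]] hc] //=; rewrite ?(mul0r, mulr0, addr0, add0r) //.
rewrite /cone_obj /= !inordE !mul1r addrC.
have -> : dots i i.-1 z = dots i i.+1 z.
  by move: (zi : z = i :> nat) hi; rewrite /dots /dist; lia.
by rewrite mulN1r addNr.
Qed.

(** Closes an identity between two signed monomials with the same coefficient by
    comparing the exponents of s. *)
Ltac monomials :=
  rewrite ?inordE ?mulXE ?(mul1r, mulr1, mulN1r, mulrN1, mulrN, mulNr, opprK, scale1r, scaleN1r, sub0r, subr0, scale0r, oppr0, mulr0z,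
     mul0r, mulr0, addr0, add0r) ?mulXE //;
  try (repeat congr (- _); congr (_ * 'X^_); rewrite /dots /dist; lia);
  try (apply/eqP; rewrite subr_eq0; apply/eqP; congr (_ * 'X^_); rewrite /dots /dist; lia).

Lemma pi_mx_beta_mx1 (z y : obj) a :
  pi_mx z ** beta_mx1 z y a = mor y z a ** pi_mx y.
Proof.
apply/matrixP => r c; rewrite [LHS]twmulE [RHS]twmulE.
under eq_bigr => m _ do rewrite !mxE.
under [RHS]eq_bigr => m _ do rewrite !mxE.
move: r c; rewrite /beta1 /beta_obj.
case: eqP => yi; case: eqP => zi r c /=; rewrite ?big_ord_recl ?big_ord0 /cmul /=;
rewrite ?mxE /bump /= ?(mul0r, mulr0, addr0, add0r) //; rewrite /= in yi zi *.
- case: c => [[|[|[|c]]] hc] //=; rewrite /cone_obj ?mulr1z ?mulrN1z /=; monomials.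
- case: (neq_cases zi) => {}zi.
    have -> : (i < z)%N = false by lia.
    case: c => [[|[|[|c]]] hc] //=; rewrite /cone_obj ?mulr1z ?mulrN1z /=; monomials.
  rewrite zi; case: c => [[|[|[|c]]] hc] //=; rewrite /cone_obj ?mulr1z ?mulrN1z /=; monomials.
- case: (neq_cases yi) => {}yi;
    rewrite ?(side_lt yi) ?(side_gt yi) /cone_obj /=; monomials.
- monomials.
Qed.

(** The functor equation in arity two: the first component is multiplicative up
    to the homotopy given by the second one. *)
Lemma beta_mx1_mul (z y x : obj) a2 a1 :
  beta_mx1 z y a2 ** beta_mx1 y x a1 - beta_mx1 z x (cmul z y x a2 a1)
  = tdiff _ ** beta_mx2 z y x a2 a1 + beta_mx2 z y x a2 a1 ** tdiff _.
Proof.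
apply/matrixP => r c; rewrite !linmxE !twmulE.
under eq_bigr => m _ do rewrite !mxE.
under [in RHS]eq_bigr => m _ do rewrite !mxE.
under [X in _ = _ + X]eq_bigr => m _ do rewrite !mxE.
rewrite mxE; move: r c; rewrite /beta1 /beta2 /beta_obj.
case: eqP => zi; case: eqP => xi; case: eqP => yi r c /=; rewrite ?big_ord_recl ?big_ord0 /cmul /=;
rewrite ?mxE /bump /= ?(mul0r, mulr0, addr0, add0r) //; rewrite /= in xi yi zi *.
- rewrite xi yi zi subrr /side ltxx sgz0 /dist ?subrr.
  case: r c => [[|[|[|r]]] hr] [[|[|[|c]]] hc] //=; rewrite /cone_obj ?mulr1z ?mulrN1z /=; monomials.
- rewrite xi zi; case: (neq_cases yi) => {}yi.
  + have -> : (i < y)%N = false by lia.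
    rewrite ?(side_lt yi) ?(side_lt' yi) ?(sgz_lt yi).
    case: r c => [[|[|[|r]]] hr] [[|[|[|c]]] hc] //=; rewrite /cone_obj ?mulr1z ?mulrN1z /=; monomials.
  + rewrite yi ?(side_gt yi) ?(side_gt' yi) ?(sgz_gt yi).
    case: r c => [[|[|[|r]]] hr] [[|[|[|c]]] hc] //=; rewrite /cone_obj ?mulr1z ?mulrN1z /=; monomials.
- rewrite yi zi subrr sgz0.
  case: (neq_cases xi) => {}xi;
    rewrite ?(side_lt xi) ?(side_gt xi);
    case: r => [[|[|[|r]]] hr] //=; rewrite /cone_obj ?mulr1z ?mulrN1z /=; monomials.
- rewrite zi; case: (neq_cases xi) => {}xi; case: (neq_cases yi) => {}yi;
    rewrite ?(side_lt xi) ?(side_gt xi) ?(side_lt yi) ?(side_gt yi) ?(sgz_lt yi) ?(sgz_gt yi).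
  + have /negbTE-> : ~~ ((i%:Z - x%:Z) * (i%:Z - y%:Z) < 0) by nia.
    case: r => [[|[|[|r]]] hr] //=; rewrite /cone_obj ?mulr1z ?mulrN1z /=; monomials.
  + have -> : ((i%:Z - x%:Z) * (i%:Z - y%:Z) < 0) by nia.
    case: r => [[|[|[|r]]] hr] //=; rewrite /cone_obj ?mulr1z ?mulrN1z /=; monomials.
  + have -> : ((i%:Z - x%:Z) * (i%:Z - y%:Z) < 0) by nia.
    case: r => [[|[|[|r]]] hr] //=; rewrite /cone_obj ?mulr1z ?mulrN1z /=; monomials.
  + have /negbTE-> : ~~ ((i%:Z - x%:Z) * (i%:Z - y%:Z) < 0) by nia.
    case: r => [[|[|[|r]]] hr] //=; rewrite /cone_obj ?mulr1z ?mulrN1z /=; monomials.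
- rewrite xi yi; case: (neq_cases zi) => {}zi.
  + have -> : (i < z)%N = false by lia.
    case: c => [[|[|[|c]]] hc] //=; rewrite /cone_obj /=; monomials.
  + rewrite zi; case: c => [[|[|[|c]]] hc] //=; rewrite /cone_obj /=; monomials.
- rewrite xi; case: (neq_cases zi) => {}zi; case: (neq_cases yi) => {}yi.
  + have -> : (i < z)%N = false by lia.
    have -> : (i < y)%N = false by lia.
    case: c => [[|[|[|c]]] hc] //=; rewrite /cone_obj /=; monomials.
  + have -> : (i < z)%N = false by lia.
    rewrite yi; case: c => [[|[|[|c]]] hc] //=; rewrite /cone_obj /=; monomials.
  + have -> : (i < y)%N = false by lia.
    rewrite zi; case: c => [[|[|[|c]]] hc] //=; rewrite /cone_obj /=; monomials.
  + rewrite zi yi; case: c => [[|[|[|c]]] hc] //=; rewrite /cone_obj /=; monomials.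
- rewrite yi; case: (neq_cases zi) => {}zi; case: (neq_cases xi) => {}xi.
  + have -> : (i < z)%N = false by lia.
    rewrite ?(side_lt xi) /cone_obj /=; monomials.
  + have -> : (i < z)%N = false by lia.
    rewrite ?(side_gt xi) /cone_obj /=; monomials.
  + rewrite zi ?(side_lt xi) /cone_obj /=; monomials.
  + rewrite zi ?(side_gt xi) /cone_obj /=; monomials.
- monomials.
Qed.

(** * Splitting the complexes of morphisms into the braided objects *)

Definition proj (x z : obj) (f : bhom x z) : {poly k} :=
  (pi_mx z ** f) ord0 ord0.

Lemma projD x z (f g : bhom x z) : proj (f + g) = proj f + proj g.
Proof. by rewrite /proj twmulDr mxE. Qed.
Lemma projN x z (f : bhom x z) : proj (- f) = - proj f.
Proof. by rewrite /proj twmulNr mxE. Qed.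
Lemma projZ x z a (f : bhom x z) : proj (a *: f) = a * proj f.
Proof. by rewrite /proj twmulZr mxE. Qed.
Lemma proj_diff x z (f : bhom x z) : proj (tdiff _ ** f) = 0.
Proof. by rewrite /proj twmulA pi_mx_diff twmul0l mxE. Qed.

Lemma proj_beta_mx1 x y z a (f : bhom x y) :
  proj (beta_mx1 z y a ** f) = cmul z y x a (proj f).
Proof. by rewrite /proj twmulA pi_mx_beta_mx1 -twmulA twmulE big_ord1 !mxE. Qed.

Lemma proj_mor x y z a (f : bhom y z) :
  proj (f ** mor x y a) = cmul z y x (proj f) a.
Proof. by rewrite /proj twmulA twmulE big_ord1 !mxE. Qed.

Lemma proj_out x z (f : bhom x z) (zi : z <> i :> nat) (r : 'I_(tsize (beta_obj k i z))) :
  r = 0%N :> nat -> proj f = f r ord0.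
Proof.
rewrite /proj twmulE; move: f r; rewrite /pi_mx /beta_obj.
case: eqP => // _ f r r0; rewrite big_ord1 /cmul !mxE /= mul1r.
by rewrite dots_end mulr1; congr (f _ _); apply: val_inj.
Qed.

Lemma tsize_in (z : obj) : z = i :> nat -> tsize (beta_obj k i z) = 3%N.
Proof. by rewrite /beta_obj; case: eqP. Qed.

(** The row with a given number, total in the number, so that rows of the cone
    can be addressed without knowing that z = i at the level of types. *)
Definition entry (x z : obj) (f : bhom x z) (n : nat) : {poly k} :=
  oapp (fun r => f r ord0) 0 (insub n).

Lemma entryE x z (f : bhom x z) (r : 'I_(tsize (beta_obj k i z))) :
  entry f r = f r ord0.
Proof. by rewrite /entry valK. Qed.
Lemma entryD x z (f g : bhom x z) n : entry (f + g) n = entry f n + entry g n.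
Proof. by rewrite /entry; case: insub => [r|] /=; rewrite ?mxE ?addr0. Qed.
Lemma entryN x z (f : bhom x z) n : entry (- f) n = - entry f n.
Proof. by rewrite /entry; case: insub => [r|] /=; rewrite ?mxE ?oppr0. Qed.
Lemma entryZ x z a (f : bhom x z) n : entry (a *: f) n = a * entry f n.
Proof. by rewrite /entry; case: insub => [r|] /=; rewrite ?mxE ?mulr0. Qed.

Lemma entry_cone x z (f : bhom x z) : z = i :> nat ->
  forall g, (forall n, (n < 3)%N -> entry f n = entry g n) -> f = g.
Proof.
move=> zi g E; apply/matrixP => r c; rewrite [c]ord1 -!entryE E //.
by case: r => r /=; rewrite tsize_in.
Qed.

Lemma entry_out x z (f : bhom x z) : z <> i :> nat -> entry f 0 = proj f.
Proof.
move=> zi; have h0 : (0 < tsize (beta_obj k i z))%N by rewrite /beta_obj; case: eqP.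
by rewrite (proj_out f zi (r := Ordinal h0)) // -entryE.
Qed.

Lemma eq_out x z (f g : bhom x z) : z <> i :> nat -> proj f = proj g -> f = g.
Proof.
move=> zi E; apply/matrixP => r c; rewrite [c]ord1.
have r0 : r = 0%N :> nat.
  by case: r => r /=; rewrite /beta_obj; case: eqP => // _; case: r.
by rewrite -!(proj_out _ zi r0).
Qed.

(** On the cone the projection adds the rows 1 and 2, composed with p_i and
    q_i. *)
Lemma proj_in x z (f : bhom x z) : z = i :> nat ->
  proj f = entry f 1 * 'X^(dots x i.-1 i) + entry f 2 * 'X^(dots x i.+1 i).
Proof.
move=> zi; rewrite /proj twmulE; move: f; rewrite /entry /pi_mx /beta_obj; case: eqP => // _ f.
rewrite !big_ord_recl big_ord0 /cmul !mxE eqxx /= !mul1r !mul0r add0r addr0.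
rewrite /cone_obj /= zi !inordE.
do 2 (case: insubP => //= ? _ ?).
by congr (f _ _ * _ + f _ _ * _); apply: val_inj.
Qed.

Lemma entry_diff x z (f : bhom x z) n : z = i :> nat ->
  entry (tdiff _ ** f) n =
  if n == 1%N then entry f 0 * 'X^(dots x i i.-1)
  else if n == 2 then - (entry f 0 * 'X^(dots x i i.+1)) else 0.
Proof.
move=> zi; case: (ltnP n (tsize (beta_obj k i z))) => hn; last first.
  rewrite {1}/entry insubN -?leqNgt //=; move: hn; rewrite tsize_in //.
  by case: n => [|[|[|n]]].
rewrite (entryE (tdiff _ ** f) (Ordinal hn)) twmulE /entry.
move: f hn; rewrite /beta_obj; case: eqP => // _ f hn.
rewrite !big_ord_recl big_ord0 /cmul !mxE /= ?(mul0r, addr0).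
case: insubP => //= s _ s0; have -> : s = ord0 by apply: val_inj.
case: n hn => [|[|[|n]]] hn //=; rewrite /cone_obj /= !inordE ?mul0r ?mul1r //.
by rewrite mulN1r mulNr.
Qed.

Lemma entry_deg0 x z (f : bhom x z) :
  z = i :> nat -> twhomog 0 f -> entry f 0 = 0.
Proof.
move=> zi; rewrite /entry; move: f; rewrite /beta_obj; case: eqP => // _ f hf.
case: insubP => //= s _ s0; apply/eqP; apply: contraTT (erefl true) => /hf.
by have -> : s = ord0 by [apply: val_inj].
Qed.

Lemma entry_degN1 x z (f : bhom x z) n : z = i :> nat -> twhomog (-1) f ->
  (0 < n)%N -> entry f n = 0.
Proof.
move=> zi; rewrite /entry; move: f; rewrite /beta_obj -zi eqxx => f hf n0.
case: insubP => //= s _ s0; apply/eqP; apply: contraTT (erefl true) => /hf.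
by case: s s0 => [[|s] hs] //= s0; move: n0; rewrite -s0.
Qed.

Lemma degN1_out x z (f : bhom x z) : z <> i :> nat -> twhomog (-1) f -> f = 0.
Proof.
move=> zi hf; apply/matrixP => r c; rewrite mxE; apply/eqP.
apply: contraTT (erefl true) => /hf.
by move: r {f hf}; rewrite /beta_obj; case: eqP.
Qed.

(** A one-sided inverse of the differential.  For x <> i one of the two entries
    of the differential is the unit, and the other entry of a boundary is read
    off from it; for x = i both entries are units and the choice is symmetric,
    which is the one that vanishes on [sect]. *)
Definition retr (x z : obj) (f : bhom x z) : bhom x z :=
  \matrix_(r, _) if (val z == i) && (val r == 0%N) then
    if (x < i)%N then - entry f 2%N
    else if (i < x)%N then entry f 1
    else 2^-1 *: (entry f 1 - entry f 2)
  else 0.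

Lemma entry_retr x z (f : bhom x z) : z = i :> nat -> entry (retr f) 0 =
    if (x < i)%N then - entry f 2%N
    else if (i < x)%N then entry f 1
    else 2^-1 *: (entry f 1 - entry f 2).
Proof.
move=> zi; rewrite {1}/entry insubT => [|h0]; first by rewrite tsize_in.
by rewrite /= mxE; case: eqP.
Qed.

Lemma retr_homog x z (f : bhom x z) : twhomog (-1) (retr f).
Proof.
move=> r c; rewrite mxE; case: ifP => [/andP[/eqP zi /eqP r0] _|]; last by rewrite eqxx.
move: r r0 {f}; rewrite /beta_obj; case: eqP => // _ r r0.
by rewrite /= /cone_deg; have -> : r = ord0 by apply: val_inj.
Qed.

Lemma retrD x z (f g : bhom x z) : retr (f + g) = retr f + retr g.
Proof.
apply/matrixP => r c; rewrite !mxE !entryD; case: ifP => _; last by rewrite addr0.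
by case: ifP => _; last case: ifP => _; rewrite ?opprD // addrACA scalerDr.
Qed.

Lemma retrZ x z a (f : bhom x z) : retr (a *: f) = a *: retr f.
Proof.
apply/matrixP => r c; rewrite !mxE !entryZ; case: ifP => _; last by rewrite mulr0.
by case: ifP => _; last case: ifP => _; rewrite ?mulrN // -mulrBr scalerAr.
Qed.

Lemma retrN x z (f : bhom x z) : retr (- f) = - retr f.
Proof. by rewrite -scaleN1r retrZ scaleN1r. Qed.

Lemma retr0 x z : retr (0 : bhom x z) = 0.
Proof. by rewrite -[X in retr X](scale0r (0 : bhom x z)) retrZ scale0r. Qed.

Lemma retr_diff x z (f : bhom x z) : twhomog (-1) f -> retr (tdiff _ ** f) = f.
Proof.
move=> hf; case: (eqVneq (z : nat) i) => [zi|/eqP zi]; last first.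
  by rewrite (degN1_out zi hf); apply: degN1_out => //; apply: retr_homog.
apply: entry_cone => // -[|n] hn; last first.
  by rewrite !entry_degN1 //; apply: retr_homog.
rewrite entry_retr // !entry_diff //= opprK.
case: ltngtP => xi.
- have -> : dots x i i.+1 = 0%N by rewrite /dots /dist; lia.
  by rewrite mulr1.
- have -> : dots x i i.-1 = 0%N by rewrite /dots /dist; lia.
  by rewrite mulr1.
- have -> : dots x i i.-1 = 0%N by rewrite /dots /dist; lia.
  have -> : dots x i i.+1 = 0%N by rewrite /dots /dist; lia.
  rewrite mulr1 -mulr2n -scaler_nat scalerA mulVf ?scale1r //.
Qed.

(** Equations in degree -1 may be checked after applying the differential. *)
Lemma diff_inj x z (f : bhom x z) : twhomog (-1) f -> tdiff _ ** f = 0 -> f = 0.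
Proof.
by move=> hf f0; rewrite -(retr_diff hf) f0 retr0.
Qed.

(** For x <> i a morphism into T_i factors through the neighbour of i on the side
    of x.  For x = i it is divided by s and split evenly between the two
    neighbours. *)
Definition sect (x z : obj) (g : {poly k}) : bhom x z :=
  \matrix_(r, _) if val z != i then g
    else if val x != i then if val r == side (x%:Z - i%:Z) then g else 0
    else if val r == 0%N then 0 else 2^-1 *: drop_poly 1 g.

Lemma entry_sect (x z : obj) (g : {poly k}) n :
  z = i :> nat -> (n < 3)%N -> entry (sect x z g) n =
    if val x != i then if n == side (x%:Z - i%:Z) then g else 0
    else if n == 0%N then 0 else 2^-1 *: drop_poly 1 g.
Proof.
move=> zi n3; rewrite {1}/entry insubT => [|h0]; first by rewrite tsize_in.
by rewrite /= mxE; case: eqP.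
Qed.

Lemma sect_homog x z g : twhomog 0 (sect x z g).
Proof.
move=> r c; rewrite mxE; move: r; rewrite /beta_obj.
case: eqP => zi //= r; rewrite /side /cone_deg.
case: r => [[|[|[|r]]] hr] //=.
by case: ifP => _; rewrite ?eqxx //; case: (0 < _)%R; rewrite eqxx.
Qed.

Lemma sect_linear x z c g h :
  sect x z (c *: g + h) = c%:P *: sect x z g + sect x z h.
Proof.
apply/matrixP => r s; rewrite !mxE.
have E (p q : {poly k}) : c *: p + q = c%:P * p + q by rewrite mul_polyC.
case: ifP => _; first by rewrite E.
case: ifP => _; case: ifP => _; rewrite ?E ?mulr0 ?addr0 //.
by rewrite -E drop_polyD drop_polyZ mul_polyC scalerDr !scalerA mulrC.
Qed.

Lemma sect0 x z : sect x z 0 = 0.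
Proof.
by have := sect_linear x z (-1) 0 0; rewrite scaler0 addr0 polyCN polyC1 scaleN1r addNr.
Qed.

(** The degree 0 part is the sum of the ideal and the boundaries. *)
Lemma sect_retr x z (f : bhom x z) : twhomog 0 f ->
  f = sect x z (proj f) + tdiff _ ** retr f.
Proof.
move=> hf; case: (eqVneq (z : nat) i) => [zi|/eqP zi]; last first.
  apply: eq_out => //; rewrite projD proj_diff addr0 -[RHS]entry_out //.
  rewrite /entry insubT => [|h0]; first by rewrite /beta_obj; case: eqP.
  by rewrite /= mxE /=; case: eqP.
apply: entry_cone => // n n3; rewrite entryD entry_diff // entry_sect // entry_retr //.
case: n n3 => [|[|[|//]]] _ /=.
- rewrite (entry_deg0 zi hf) /side addr0; case: ifP => // _; by case: (0 < _)%R.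
- rewrite proj_in //; case: ltngtP => xi; rewrite /= ?(side_lt xi) ?(side_gt xi) /=.
  + by rewrite !(dots_lt xi) expr0 expr1; ring.
  + by rewrite !(@dots_gt x i) ?i_gt0 // expr0 mulr1 add0r.
  + rewrite xi !dots_eq // -mulrDl drop_polyMXn_id expr0 mulr1 -scalerDr.
    by rewrite addrACA subrr addr0 -mulr2n -scaler_nat scalerA mulVf ?scale1r.
- rewrite proj_in //; case: ltngtP => xi; rewrite /= ?(side_lt xi) ?(side_gt xi) /=.
  + by rewrite !(dots_lt xi) expr0; ring.
  + by rewrite !(@dots_gt x i) ?i_gt0 // expr0 expr1; ring.
  + rewrite xi !dots_eq // -mulrDl drop_polyMXn_id expr0 mulr1 -scalerBr.
    rewrite opprB addrCA addrAC subrr add0r.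
    by rewrite -mulr2n -scaler_nat scalerA mulVf ?scale1r.
Qed.

(** The hypothesis says that g lies in the ideal. *)
Lemma proj_sect (x z : obj) (g : {poly k}) :
  (z = i :> nat -> x = i :> nat -> g`_0 = 0) ->
  proj (sect x z g) = g.
Proof.
move=> g0; case: (eqVneq (z : nat) i) => [zi|/eqP zi]; last first.
  rewrite -entry_out // /entry insubT => [|h0]; first by rewrite /beta_obj; case: eqP.
  by rewrite /= mxE /=; case: eqP.
rewrite proj_in // !entry_sect //; case: eqP => /= xi; last first.
  case: (neq_cases xi) => {}xi; rewrite ?(side_lt xi) ?(side_gt xi) /=.
    by rewrite !(dots_lt xi) expr0; ring.
  by rewrite !(@dots_gt x i) ?i_gt0 // expr0; ring.
have {}xi : x = i :> nat by [].
rewrite xi !dots_eq // -mulrDl -scalerDl -mulr2n -[_ *+ 2]mulr_natr mulVf // scale1r.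
rewrite -[RHS](poly_take_drop 1) [take_poly 1 g](_ : _ = 0) ?add0r //.
apply/polyP => -[|n]; rewrite coef_take_poly coef0 ?g0 //.
Qed.

Lemma proj_coef0 x z (f : bhom x z) :
  z = i :> nat -> x = i :> nat -> (proj f)`_0 = 0.
Proof.
by move=> zi xi; rewrite proj_in // xi !dots_eq // -mulrDl coefMX.
Qed.

Lemma retr_sect (x z : obj) (g : {poly k}) : retr (sect x z g) = 0.
Proof.
case: (eqVneq (z : nat) i) => [zi|/eqP zi]; last first.
  by apply: degN1_out => //; apply: retr_homog.
apply: entry_cone => // -[|n] hn; last first.
  by rewrite !entry_degN1 //; [apply: twhomog0 | apply: retr_homog].
have -> : entry (0 : bhom x z) 0 = 0 by rewrite /entry; case: insub => //= ?; rewrite mxE.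
rewrite entry_retr // !entry_sect //; case: eqP => /= xi.
  have {}xi : x = i :> nat by [].
  by rewrite xi ltnn /= subrr scaler0.
case: (neq_cases xi) => {}xi; first by rewrite xi (side_lt xi) /= oppr0.
have -> : (x < i)%N = false by lia.
by rewrite xi (side_gt xi).
Qed.

(** * The components of eta *)

Lemma sect_klinear (x z : obj) r : @klinear k (fun g => sect x z g r ord0).
Proof. by move=> c f g; rewrite (sect_linear x z c f g) !mxE mul_polyC. Qed.

Section EtaEntries.
Variable th : theta_space k N i.
Let te := theta_ext th.

Lemma theta_ext_i : te i = 0.
Proof.
rewrite /te /theta_ext; case: insubP => //= j _ ji.
by case: insubP => //= j' /andP[_]; rewrite ji eqxx.
Qed.

Lemma eta_short (x z : obj) d (p : chain k x d z) : (d < 2)%N -> eta th p = 0.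
Proof.
move=> d2; apply/matrixP => r c; rewrite !mxE.
by case: p d2 r c => //= d' y z' a [].
Qed.

Lemma eta_long (x z : obj) d (p : chain k x d z) : (3 < d)%N -> eta th p = 0.
Proof.
move=> d2; apply/matrixP => r c; rewrite !mxE.
case: p d2 r c => //= d1 y1 z1 a1 p; case: p => //= d2 y2 z2 a2 p.
case: p => //= d3 y3 z3 a3 p; case: p => //=.
Qed.

Lemma eta_mx2 (z y x : obj) a2 a1 r c :
  eta th (ccons z a2 (arr y a1 x)) r c =
  lin_of (fun b => lin_of (fun a => eta2 i te x y z b a r) a1) a2.
Proof. by rewrite mxE /= (lin_of2E (fun b a => eta2 i te x y z b a r)). Qed.

Lemma eta_mx3 (z l y x : obj) a3 a2 a1 r s :
  eta th (ccons z a3 (ccons l a2 (arr y a1 x))) r s =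
  lin_of (fun c => lin_of (fun b => lin_of (fun a =>
    eta3 i te x y l z c b a r) a1) a2) a3.
Proof.
by rewrite mxE /= (lin_of3E (fun c b a => eta3 i te x y l z c b a r)).
Qed.

(** The second component of eta is the section of the cochain defined by the
    coefficient function, in all three cases of its definition. *)
Lemma eta_sect (z y x : obj) a2 a1 :
  eta th (ccons z a2 (arr y a1 x)) = sect x z (coef_cochain te z y x a2 a1).
Proof.
apply/matrixP => r c; rewrite [c]ord1 eta_mx2 /coef_cochain.
rewrite (klinear_lin_of _ _ (@sect_klinear x z r)); apply: eq_lin_of => b /=.
rewrite (klinear_lin_of _ _ (@sect_klinear x z r)); apply: eq_lin_of => a /=.
rewrite /eta2 mxE -/te; case: eqP => zi //=.
have {}zi : z = i :> nat by [].
case: eqP => xi /=; last by rewrite zi; case: ifP; rewrite ?scale0r //.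
have {}xi : x = i :> nat by [].
case: ifP => // _; rewrite drop_polyZ scalerA.
(* When the exponent is truncated, the coefficient is 0 because theta_i = 0. *)
case: (posnP (b + a + dots x y z - 1)) => H.
  rewrite zi xi (@coef_loop _ te i y b a) ?theta_ext_i ?mulr0 ?mul0r ?scale0r //.
  by move: H; rewrite zi xi /dots /dist; lia.
rewrite -[in RHS](subnK H) exprD drop_polyMXn_id xi zi; congr (_ *: 'X^_).
by rewrite /dots /dist; lia.
Qed.

Lemma eta_homog x d z (p : chain k x d z) : twhomog (2 - d%:Z) (eta th p).
Proof.
case: (ltnP d 2) => [d2|d2]; first by rewrite eta_short //; apply: twhomog0.
case: (ltnP 3 d) => [d3|d3]; first by rewrite eta_long //; apply: twhomog0.
have /orP[/eqP d2'|/eqP d3'] : (d == 2) || (d == 3) by lia.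
  move: p; rewrite d2' => p; have [y [a2 [a1 ->]]] := chain2P p.
  rewrite eta_sect; exact: sect_homog.
move: p; rewrite d3' => p; have [l [y [a3 [a2 [a1 ->]]]]] := chain3P p.
move=> r c; rewrite eta_mx3; move: r c; rewrite /eta3 -[fobj B z]/(beta_obj k i z) /beta_obj.
case: eqP => zi r c /=.
  case: (eqVneq (r : nat) 0%N) => r0; first by rewrite /cone_deg (_ : r = ord0) //; apply: val_inj.
  rewrite (_ : lin_of _ _ = 0) ?eqxx //.
  rewrite /lin_of big1 // => ? _; rewrite big1 ?scaler0 // => ? _.
  by rewrite big1 ?scaler0 // => ? _; rewrite scaler0.
rewrite (_ : lin_of _ _ = 0) ?eqxx //.
rewrite /lin_of big1 // => ? _; rewrite big1 ?scaler0 // => ? _.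
by rewrite big1 ?scaler0 // => ? _; rewrite scaler0.
Qed.

Lemma eta_multilin (c : k) x d z (p p1 p2 : chain k x d z) :
  slot_comb c p p1 p2 -> eta th p = c%:P *: eta th p1 + eta th p2.
Proof.
case: (ltnP d 2) => [d2|d2].
  by move=> _; rewrite !(eta_short _ d2) scaler0 addr0.
case: (ltnP 3 d) => [d3|d3].
  by move=> _; rewrite !(eta_long _ d3) scaler0 addr0.
move=> H; apply/matrixP => r s; rewrite !linmxE mul_polyC.
case: H d2 d3 r s => [d1 y1 z1 a b q|d1 y1 z1 a q q1 q2 H] d2 d3 r s.
  case: q d2 d3 => //= d2 y2 z2 a' q; case: q => [|d3 y3 z3 a'' q] _ dd.
    by rewrite !eta_mx2 lin_of_klinear.
  by case: q dd => //= _; rewrite !eta_mx3 lin_of_klinear.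
case: H d2 d3 r s => [e2 y2 z2 a' b s|e2 y2 z2 a' s s1 s2 H].
  case: s => [|d3 y3 z3 a'' s] _ dd r t.
    rewrite !eta_mx2; exact: lin_of2_r.
  by case: s dd => //= _; rewrite !eta_mx3; apply: lin_of3_m.
case: H => [d3 y3 z3 a'' b t|d3 y3 z3 a'' t t1 t2 H] _ dd r v.
  by case: t dd => //= _; rewrite !eta_mx3; apply: lin_of3_r.
by case: H dd.
Qed.

End EtaEntries.

Definition cone_pos (n : nat) : nat :=
  if n == 0%N then i else if n == 1%N then i.-1 else i.+1.

Lemma cone_objE (r : 'I_3) : cone_obj N i r = cone_pos r :> nat.
Proof.
rewrite /cone_obj /cone_pos.
by case: r => [[|[|[|r]]] hr] //=; rewrite inordE.
Qed.

Lemma entry_mor (x y z : obj) (f : bhom y z) a n : z = i :> nat -> (n < 3)%N ->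
  entry (f ** mor x y a) n = entry f n * a * 'X^(dots x y (cone_pos n)).
Proof.
move=> zi n3; have hn : (n < tsize (beta_obj k i z))%N by rewrite tsize_in.
rewrite (entryE (f ** _) (Ordinal hn)) (entryE f (Ordinal hn)) twmulE big_ord1 /cmul mxE.
congr (_ * _ * 'X^(dots _ _ _)); move: f hn; rewrite /beta_obj; case: eqP => // _ f hn.
exact: cone_objE.
Qed.

Lemma entry_beta_mx1_out (x l z : obj) (f : bhom x l) a n :
  z = i :> nat -> l <> i :> nat ->
  (n < 3)%N -> entry (beta_mx1 z l a ** f) n =
  if n == side (l%:Z - i%:Z) then a * proj f * 'X^(dots x l (cone_pos n)) else 0.
Proof.
move=> zi li n3; have hn : (n < tsize (beta_obj k i z))%N by rewrite tsize_in.
rewrite (entryE (beta_mx1 z l a ** f) (Ordinal hn)) twmulE.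
under eq_bigr => m _ do rewrite /cmul mxE -(entryE f) /beta1.
rewrite -(entry_out f li); move: (entry f) => e.
move: {f}hn; rewrite /beta_obj; case: eqP => // _; case: eqP => // _ hn.
rewrite big_ord1 /= cone_objE /=; case: ifP => // _; by rewrite !mul0r.
Qed.

Lemma entry_beta_mx1_in (x l z : obj) (f : bhom x l) a n :
  z = i :> nat -> l = i :> nat ->
  (n < 3)%N -> entry (beta_mx1 z l a ** f) n = a * entry f n.
Proof.
move=> zi li n3; have hn : (n < tsize (beta_obj k i z))%N by rewrite tsize_in.
rewrite (entryE (beta_mx1 z l a ** f) (Ordinal hn)) twmulE.
under eq_bigr => m _ do rewrite /cmul mxE -(entryE f) /beta1.
move: (entry f) => e.
move: {f}hn; rewrite /beta_obj; case: eqP => // _; case: eqP => // _ hn.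
rewrite (bigD1 (Ordinal n3)) //= eqxx big1 => [|m mn].
  rewrite !cone_objE /=.
  have -> : dots x (cone_pos n) (cone_pos n) = 0%N by rewrite dots_end.
  by rewrite addr0 mulr1.
rewrite ifN ?mul0r //; apply: contra mn => /eqP nm; apply/eqP.
by apply: val_inj.
Qed.

Lemma half2 : 2^-1 * (1 - -1) = 1 :> k.
Proof. by rewrite opprK -[1 + 1]/(2%:R) mulVf. Qed.
Lemma half2N : 2^-1 * (- 1 - 1) = -1 :> k.
Proof. by rewrite -opprD -[1 + 1]/(2%:R) mulrN mulVf. Qed.

(** How far [sect] is from commuting with the left action: the result lies on the
    side of l, whereas the section lies on the side of x. *)
Lemma retr_beta_mx1_sect (x l z : obj) a g : z = i :> nat ->
  entry (retr (beta_mx1 z l a ** sect x l g)) 0 =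
  if val l == i then 0
  else (2^-1 * (sg x - sg l)) *: (a * g * 'X^(dots x l i - 1)).
Proof.
move=> zi; rewrite entry_retr //; case: eqP => li.
  rewrite !entry_beta_mx1_in // !entry_sect //.
  case: eqP => /= xi.
    have {}xi : x = i :> nat by [].
    by rewrite xi ltnn subrr scaler0.
  case: (neq_cases xi) => {}xi; first by rewrite xi (side_lt xi) mulr0 oppr0.
  have -> : (x < i)%N = false by lia.
  by rewrite xi (side_gt xi) mulr0.
have {}li : l <> i :> nat by [].
rewrite !entry_beta_mx1_out // proj_sect // /cone_pos /=.
case: (neq_cases li) => {}li; rewrite ?(side_lt li) ?(side_gt li) ?(sg_lt li) ?(sg_gt li) /=.
- case: (ltngtP (x : nat) i) => xi.
  + by rewrite sg_lt // subrr mulr0 scale0r oppr0.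
  + rewrite sg_gt // half2 scale1r; congr (_ * 'X^_); rewrite /dots /dist; lia.
  + rewrite xi sg_eq subr0 sub0r opprK mulr1; congr (_ *: (_ * 'X^_)); rewrite /dots /dist; lia.
- case: (ltngtP (x : nat) i) => xi.
  + rewrite sg_lt // half2N scaleN1r; congr (- (_ * 'X^_)); rewrite /dots /dist; lia.
  + by rewrite sg_gt // subrr mulr0 scale0r.
  + rewrite xi sg_eq !sub0r mulrN1 scalerN scaleNr; congr (- (_ *: (_ * 'X^_))); rewrite /dots /dist; lia.
Qed.

(** How far [sect] is from commuting with the right action: the result lies on
    the side of y instead of the side of x. *)
Lemma retr_sect_mor (x y z : obj) a g : z = i :> nat ->
  entry (retr (sect y z g ** mor x y a)) 0 =
  if val y == i then (2^-1 * sg x) *: (drop_poly 1 g * a)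
  else (2^-1 * (sg x - sg y)) *: (g * a * 'X^(dots x y i - 1)).
Proof.
move=> zi; rewrite entry_retr // !entry_mor // !entry_sect // /cone_pos /=.
case: eqP => yi /=.
- have {}yi : y = i :> nat by [].
  rewrite yi; case: (ltngtP (x : nat) i) => xi.
  + have -> : dots x i i.+1 = 0%N by rewrite /dots /dist; lia.
    by rewrite sg_lt // mulr1 mulrN1 scaleNr scalerAl.
  + have -> : dots x i i.-1 = 0%N by rewrite /dots /dist; lia.
    by rewrite sg_gt // !mulr1 scalerAl.
  + have -> : dots x i i.-1 = dots x i i.+1 by rewrite xi /dots /dist; lia.
    by rewrite xi sg_eq mulr0 scale0r subrr scaler0.
- have {}yi : y <> i :> nat by [].
  case: (neq_cases yi) => {}yi; rewrite ?(side_lt yi) ?(side_gt yi) ?(sg_lt yi) ?(sg_gt yi) /= ?mul0r.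
  + case: (ltngtP (x : nat) i) => xi.
    * by rewrite sg_lt // subrr mulr0 scale0r oppr0.
    * rewrite sg_gt // half2 scale1r; congr (_ * 'X^_); rewrite /dots /dist; lia.
    * rewrite xi sg_eq subr0 sub0r opprK mulr1; congr (_ *: (_ * 'X^_)); rewrite /dots /dist; lia.
  + case: (ltngtP (x : nat) i) => xi.
    * rewrite sg_lt // half2N scaleN1r; congr (- (_ * 'X^_)); rewrite /dots /dist; lia.
    * by rewrite sg_gt // subrr mulr0 scale0r.
    * rewrite xi sg_eq !sub0r mulrN1 scalerN scaleNr; congr (- (_ *: (_ * 'X^_))); rewrite /dots /dist; lia.
Qed.

(** * The transformations eta are closed *)

Lemma mor_mul (x y z : obj) a b :
  mor y z a ** mor x y b = mor x z (cmul z y x a b).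
Proof. by apply/matrixP => r c; rewrite twmulE big_ord1 !mxE. Qed.

(** There is nothing in degree 1. *)
Lemma diff_deg0 (x z : obj) (f : bhom x z) : twhomog 0 f -> tdiff _ ** f = 0.
Proof.
move=> hf; have {}hf : twhomog 1 (tdiff _ ** f).
  by rewrite -[1](addr0 1); apply: twhomogM => //; apply: tdiff_homog.
apply/matrixP => r c; rewrite [RHS]mxE; apply/eqP; apply: contraTT (erefl true) => /hf /=.
move: r {hf f}; rewrite /beta_obj; case: eqP => // _ r.
by rewrite /= /cone_deg; case: ifP.
Qed.

(** The homotopy of [beta_mx1_mul] acting on a cycle. *)
Lemma diff_beta_mx2 (w x y z : obj) a2 a1 (f : bhom w x) : twhomog 0 f ->
  tdiff _ ** (beta_mx2 z y x a2 a1 ** f) =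
  beta_mx1 z y a2 ** (beta_mx1 y x a1 ** f) - beta_mx1 z x (cmul z y x a2 a1) ** f.
Proof.
move=> hf; rewrite !twmulA -twmulBl beta_mx1_mul twmulDl -[X in _ = _ + X]twmulA.
by rewrite diff_deg0 // twmul0r addr0.
Qed.

Section Coef3.
Variable th : nat -> k.
Hypothesis th_i : th i = 0.

(** The coefficient of eta^3 adds up the two defects of the section.  For l and y
    other than i, an object x of another sign forces a dot at i, so the exponent
    is not truncated, and equal signs give the coefficient 0; for y = i the
    truncated exponent is covered by [coef_loop]. *)
Lemma coef3_monomial (l y x c b a : nat) :
  (if l == i then 0
   else (2^-1 * (sg x - sg l)) *: ('X^c * coef_cochain th l y x 'X^b 'X^a * 'X^(dots x l i - 1)))
  - (if y == i then (2^-1 * sg x) *: (drop_poly 1 (coef_cochain th i l y 'X^c 'X^b) * 'X^a)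
     else (2^-1 * (sg x - sg y)) *: (coef_cochain th i l y 'X^c 'X^b * 'X^a * 'X^(dots x y i - 1)))
  = coef3 i th l c y b x *: 'X^(c + b + a + dots4 x y l i - 2) :> {poly k}.
Proof.
set M := (c + b + a + dots4 x y l i - 2)%N.
have D : (dots4 x y l i = dots x l i + dots x y l)%N.
  by rewrite /dots4 addnC dotsA addnC; have := dotsA x y l i; lia.
have -> : (if l == i then 0
   else (2^-1 * (sg x - sg l)) *: ('X^c * coef_cochain th l y x 'X^b 'X^a * 'X^(dots x l i - 1)))
  = (if l == i then 0 else (2^-1 * (sg x - sg l) * coef th l y b x)) *: 'X^M :> {poly k}.
  case: eqP => li; first by rewrite scale0r.
  rewrite coef_cochainX.
  (* Without a dot at i, the objects x and l lie on the same side of i. *)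
  case: (posnP (dots x l i)) => d0.
    have -> : sg x = sg l.
      move: d0; case: (ltngtP x i) => xi; case: (ltngtP l i) => // l_i;
        rewrite ?(sg_lt xi) ?(sg_gt xi) ?(sg_lt l_i) ?(sg_gt l_i) // => d0;
        exfalso; move: d0; rewrite /dots /dist; lia.
    by rewrite subrr mulr0 mul0r !scale0r.
  rewrite -scalerAr -scalerAl [_ *: (_ *: _)]scalerA.
  have -> : 'X^c * 'X^(b + a + dots x y l - 1) * 'X^(dots x l i - 1) =
    'X^(b + a + dots x y l - 1) * 'X^(c + (dots x l i - 1)) :> {poly k}.
    by rewrite exprD; ring.
  rewrite -scalerA [coef _ _ _ _ _ *: (_ * _)]scalerAl coef_shift scalerA.
  by congr (_ *: 'X^_); rewrite /M D; lia.
have D' : (dots4 x y l i = dots x y i + dots y l i)%N by [].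
have -> : (if y == i then (2^-1 * sg x) *: (drop_poly 1 (coef_cochain th i l y 'X^c 'X^b) * 'X^a)
     else (2^-1 * (sg x - sg y)) *: (coef_cochain th i l y 'X^c 'X^b * 'X^a * 'X^(dots x y i - 1)))
  = (2^-1 * (sg x - sg y) * coef th i l c y) *: 'X^M :> {poly k}.
  rewrite coef_cochainX; case: eqP => yi.
    rewrite yi sg_eq subr0 drop_polyZ -scalerAl scalerA.
    case: (posnP (c + b + dots i l i - 1)) => H.
      rewrite (@coef_loop _ th i l c b) ?mulr0 ?scale0r //.
      by move: H; rewrite /dots /dist; lia.
    rewrite -(subnK H) exprD drop_polyMXn_id -exprD; congr (_ *: 'X^_).
    by rewrite /M D' yi dots_end; lia.
  (* Without a dot at i, the objects x and y lie on the same side of i. *)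
  case: (posnP (dots x y i)) => d0.
    have -> : sg x = sg y.
      move: d0; case: (ltngtP x i) => xi; case: (ltngtP y i) => // y_i;
        rewrite ?(sg_lt xi) ?(sg_gt xi) ?(sg_lt y_i) ?(sg_gt y_i) // => d0;
        exfalso; move: d0; rewrite /dots /dist; lia.
    by rewrite subrr mulr0 mul0r !scale0r.
  rewrite -mulrA -exprD coef_shift scalerA.
  by congr (_ *: 'X^_); rewrite /M D'; lia.
rewrite -scalerBl; congr (_ *: _); rewrite /coef3.
by case: eqP => li /=; ring.
Qed.

End Coef3.

Section EtaClosed.
Variable th : theta_space k N i.
Let te := theta_ext th.

Lemma entry_eta3 (z l y x : obj) a3 a2 a1 : z = i :> nat ->
  entry (eta th (ccons z a3 (ccons l a2 (arr y a1 x))) : bhom x z) 0 =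
  lin_of (fun c => lin_of (fun b => lin_of (fun a =>
    coef3 i te l c y b x *: 'X^(c + b + a + dots4 x y l i - 2)) a1) a2) a3.
Proof.
move=> zi; have hn : (0 < tsize (beta_obj k i z))%N by rewrite tsize_in.
rewrite (entryE _ (Ordinal hn)) eta_mx3 /eta3 /=.
by case: eqP.
Qed.

Lemma coef_cochain_theta_ideal (w v u : obj) f g :
  w = i :> nat -> u = i :> nat -> (coef_cochain te w v u f g)`_0 = 0.
Proof.
by move=> wi ui; rewrite wi ui coef_cochain_ideal //; apply: theta_ext_i.
Qed.

(** Three linear slots reduce the identity to [coef3_monomial]. *)
Lemma entry_eta3_retr (z l y x : obj) a3 a2 a1 : z = i :> nat ->
  entry (retr (beta_mx1 z l a3 ** sect x l (coef_cochain te l y x a2 a1))) 0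
  - entry (retr (sect y z (coef_cochain te z l y a3 a2) ** mor x y a1)) 0
  = entry (eta th (ccons z a3 (ccons l a2 (arr y a1 x))) : bhom x z) 0.
Proof.
move=> zi; rewrite retr_beta_mx1_sect // retr_sect_mor // entry_eta3 // zi.
pose G (a3 a2 a1 : {poly k}) := lin_of (fun c => lin_of (fun b => lin_of (fun a =>
    coef3 i te l c y b x *: 'X^(c + b + a + dots4 x y l i - 2)) a1) a2) a3.
pose F (a3 a2 a1 : {poly k}) : {poly k} := (if l == i :> nat then 0
   else (2^-1 * (sg x - sg l)) *: (a3 * coef_cochain te l y x a2 a1 * 'X^(dots x l i - 1)))
  - (if y == i :> nat then (2^-1 * sg x) *: (drop_poly 1 (coef_cochain te i l y a3 a2) * a1)
     else (2^-1 * (sg x - sg y)) *: (coef_cochain te i l y a3 a2 * a1 * 'X^(dots x y i - 1))).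
suff : forall a3 a2 a1, F a3 a2 a1 = G a3 a2 a1 by apply.
move=> {a3 a2 a1} a3 a2 a1.
have mulZ c (f g h : {poly k}) : (c *: f + g) * h = c *: (f * h) + g * h.
  by rewrite mulrDl scalerAl.
have mulZr c (f g h : {poly k}) : h * (c *: f + g) = c *: (h * f) + h * g.
  by rewrite mulrDr scalerAr.
have sc (e c : k) (f g : {poly k}) : e *: (c *: f + g) = c *: (e *: f) + e *: g.
  by rewrite scalerDr !scalerA mulrC.
have sb (c : k) (f g f' g' : {poly k}) :
    (c *: f + g) - (c *: f' + g') = c *: (f - f') + (g - g').
  by rewrite scalerBr opprD addrACA.
have z0 (c : k) : 0 = c *: 0 + 0 :> {poly k} by rewrite scaler0 addr0.
have l3 u v : klinear (fun f => F f u v).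
{ move=> c f g; rewrite /F -sb; congr (_ - _); case: ifP => _; rewrite -?z0 //.
  - by rewrite !mulZ sc.
  - by rewrite coef_cochain_linl drop_polyD drop_polyZ mulZ sc.
  - by rewrite coef_cochain_linl !mulZ sc. }
have l2 u v : klinear (fun f => F u f v).
{ move=> c f g; rewrite /F -sb; congr (_ - _); case: ifP => _; rewrite -?z0 //.
  - by rewrite coef_cochain_linl mulZr mulZ sc.
  - by rewrite coef_cochain_linr drop_polyD drop_polyZ mulZ sc.
  - by rewrite coef_cochain_linr !mulZ sc. }
have l1 u v : klinear (F u v).
{ move=> c f g; rewrite /F -sb; congr (_ - _); case: ifP => _; rewrite -?z0 //.
  - by rewrite coef_cochain_linr mulZr mulZ sc.
  - by rewrite mulZr sc.
  - by rewrite mulZr !mulZ sc. }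
apply: (klinear_ext (l3 _ _) (lin_of_klinear _)) => n3 {a3}.
apply: (klinear_ext (l2 _ _) (lin_of3_m _ _ _)) => n2 {a2}.
apply: (klinear_ext (l1 _ _) (lin_of3_r _ _ _)) => n1 {a1}.
rewrite /F /G !lin_ofX; apply: coef3_monomial.
exact: theta_ext_i.
Qed.

(** The equation in arity three.  Both sides have degree 0, so it splits into its
    projection, which is the cocycle identity, and its retraction, which defines
    eta^3. *)
Lemma eta_diff3 (z l y x : obj) a3 a2 a1 :
  tdiff _ ** (eta th (ccons z a3 (ccons l a2 (arr y a1 x))) : bhom x z) =
  beta_mx1 z l a3 ** (eta th (ccons l a2 (arr y a1 x)) : bhom x l)
  - (eta th (ccons z a3 (arr l a2 y)) : bhom y z) ** mor x y a1
  - (eta th (ccons z (cmul z l y a3 a2) (arr y a1 x)) : bhom x z)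
  + (eta th (ccons z a3 (arr l (cmul l y x a2 a1) x)) : bhom x z).
Proof.
rewrite !eta_sect -/te.
set R := (X in _ = X).
have hR : twhomog 0 R.
  apply: twhomogD; last exact: sect_homog.
  apply: twhomogB; last exact: sect_homog.
  apply: twhomogB.
    rewrite -[0](addr0 0); apply: twhomogM; last exact: sect_homog.
    exact: beta_mx1_homog.
  by rewrite -[0](addr0 0); apply: twhomogM; [exact: sect_homog | exact: const_homog].
rewrite (sect_retr hR).
have -> : proj R = 0.
  rewrite /R !projD !projN proj_beta_mx1 // proj_mor !proj_sect; try exact: coef_cochain_theta_ideal.
  exact: coef_cochain_cocycle.
rewrite sect0 add0r; congr (_ ** _).
case: (eqVneq (z : nat) i) => [zi|/eqP zi]; last first.
  rewrite [LHS](degN1_out zi); last exact: eta_homog.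
  by rewrite [RHS](degN1_out zi) //; apply: retr_homog.
apply: entry_cone => // -[|n] hn; last first.
  rewrite !entry_degN1 //; first exact: retr_homog.
  exact: eta_homog.
rewrite -entry_eta3_retr // /R !retrD !retrN !retr_sect oppr0 !addr0.
by rewrite entryD entryN.
Qed.

(** In arity four the value has degree -1.  After applying the differential,
    [eta_diff3] expresses everything by eta^2, and the terms cancel by the
    functor equations. *)
Lemma eta_closed x d z (p : chain k x d z) : nat_mu1 2 (eta th) p = 0.
Proof.
have hom := nat_mu1_homog (@beta_mor_homog) (@eta_homog th).
(* In the other arities the value has a degree in which beta T_z vanishes. *)
case: (boolP ((d == 3) || (d == 4))) => [/orP[]/eqP dE|dn]; first last.
- apply/matrixP => r c; rewrite [RHS]mxE; apply/eqP; apply: contraNT dn => /hom /=.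
  have : (tdeg r == 0) || (tdeg r == -1).
    move: r; rewrite -[fobj B z]/(beta_obj k i z) /beta_obj; case: eqP => // _ r /=.
    by rewrite /cone_deg; case: ifP.
  case/orP => /eqP->; lia.
- move: p; rewrite dE => p; have [m [l [y [a4 [a3 [a2 [a1 ->]]]]]]] := chain4P p.
  have E := @nat_mu1_4_deg2 k N B (eta th) z m l y x a4 a3 a2 a1 (eta_short th (cnil k x) isT)
    (eta_short th (arr y a1 x) isT)
    (eta_long th (ccons z a4 (ccons m a3 (ccons l a2 (arr y a1 x)))) isT).
  rewrite !beta_mor1 beta_mor2 in E.
  apply: diff_inj; first exact: hom.
  rewrite E !(twmulDr, twmulNr) !twmulA beta_mx1_chain.
  rewrite -!twmulA !eta_diff3 diff_beta_mx2; last by rewrite eta_sect; apply: sect_homog.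
  rewrite [tdiff _ ** (_ ** _)]twmulA eta_diff3 !(twmulDr, twmulDl, twmulNr, twmulNl).
  rewrite -!twmulA mor_mul (cmulA _ _ _ _ a4 a3 a2) (cmulA _ _ _ _ a3 a2 a1).
  mxring.
- move: p; rewrite dE => p; have [l [y [a3 [a2 [a1 ->]]]]] := chain3P p.
  have E := @nat_mu1_3_deg2 k N B (eta th) z l y x a3 a2 a1
    (eta_short th (cnil k x) isT) (eta_short th (arr y a1 x) isT).
  rewrite E !beta_mor1 eta_diff3; mxring.
Qed.

End EtaClosed.

(** * Classification *)

Lemma deg_vanish (x z : obj) n (f : bhom x z) : twhomog n f ->
  n != 0 -> n != -1 -> f = 0.
Proof.
move=> hf n0 n1; apply/matrixP => r c; rewrite [RHS]mxE; apply/eqP.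
apply: contraTT (erefl true) => /hf /=.
have : (tdeg r == 0) || (tdeg r == -1).
  move: r {f hf}; rewrite /beta_obj; case: eqP => // _ r /=.
  by rewrite /cone_deg; case: ifP.
by case/orP => /eqP->; move: n0 n1; lia.
Qed.

Lemma prenat_vanish g (xi : prenat B) x d z (p : chain k x d z) :
  is_prenat g xi -> g - d%:Z != 0 -> g - d%:Z != -1 -> xi x d z p = 0.
Proof.
by move=> hxi g0 g1; have [hom _] := hxi x d z; apply: deg_vanish (hom p) g0 g1.
Qed.

Lemma beta_mx1_linear (z y : obj) (c : k) (a b : {poly k}) :
  beta_mx1 z y (c *: a + b) = c%:P *: beta_mx1 z y a + beta_mx1 z y b.
Proof.
apply/matrixP => r s; rewrite !mxE mul_polyC /beta1.
have z0 : 0 = c *: 0 + 0 :> {poly k} by rewrite scaler0 addr0.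
by do !case: ifP => _; rewrite -?z0 ?mulrDl ?scalerAl.
Qed.

Lemma mor_linear (x y : obj) (c : k) (a b : {poly k}) :
  mor x y (c *: a + b) = c%:P *: mor x y a + mor x y b.
Proof. by apply/matrixP => r s; rewrite !mxE mul_polyC. Qed.

Section Cochain.
Variable chi : prenat B.
Hypothesis chiP : is_nat_transf 2 chi.

(** The Hochschild 2-cochain with values in the ideal that underlies a closed
    transformation. *)
Definition shadow (w v u : nat) (f g : {poly k}) : {poly k} :=
  proj (chi (ccons (inord w) f (arr (inord v) g (inord u))) : bhom _ _).

Lemma shadowE (z y x : obj) f g :
  shadow z y x f g = proj (chi (ccons z f (arr y g x)) : bhom _ _).
Proof. by rewrite /shadow !inord_val. Qed.

Lemma chi_lin x d z c (p p1 p2 : chain k x d z) : slot_comb c p p1 p2 ->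
  chi p = c%:P *: chi p1 + chi p2.
Proof. by case: chiP => h _; case: (h x d z) => _; apply. Qed.

Lemma shadow_linl w v u g : klinear (fun f => shadow w v u f g).
Proof.
move=> c f f'; rewrite /shadow (chi_lin (slot_here c _ f f' _)).
by rewrite (projD _ (chi _ : bhom _ _)) projZ mul_polyC.
Qed.

Lemma shadow_linr w v u f : klinear (shadow w v u f).
Proof.
move=> c g g'; rewrite /shadow (chi_lin (slot_there _ _ (slot_here c _ g g' _))).
by rewrite (projD _ (chi _ : bhom _ _)) projZ mul_polyC.
Qed.

Lemma chi_diff3 (z l y x : obj) a3 a2 a1 :
  tdiff _ ** (chi (ccons z a3 (ccons l a2 (arr y a1 x))) : bhom x z) =
  beta_mx1 z l a3 ** (chi (ccons l a2 (arr y a1 x)) : bhom x l)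
  - (chi (ccons z a3 (arr l a2 y)) : bhom y z) ** mor x y a1
  - (chi (ccons z (cmul z l y a3 a2) (arr y a1 x)) : bhom x z)
  + (chi (ccons z a3 (arr l (cmul l y x a2 a1) x)) : bhom x z).
Proof.
case: chiP => h cl.
have c0 := prenat_vanish (cnil k x) h isT isT.
have c1 := prenat_vanish (arr y a1 x) h isT isT.
have := cl _ _ _ (ccons z a3 (ccons l a2 (arr y a1 x))).
rewrite (@nat_mu1_3_deg2 k N B chi z l y x a3 a2 a1 c0 c1) !beta_mor1 => E.
by apply/eqP; rewrite -subr_eq0 -oppr_eq0; apply/eqP; rewrite -[RHS]E; mxring.
Qed.

Lemma cmul_inord w v u (f g : {poly k}) :
  (w <= N)%N -> (v <= N)%N -> (u <= N)%N ->
  cmul (inord w : obj) (inord v) (inord u) f g = ncmul w v u f g.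
Proof. by move=> hw hv hu; rewrite /cmul /ncmul !inordK. Qed.

Lemma shadow_cocycle w v u t a3 a2 a1 :
  (w <= N)%N -> (v <= N)%N -> (u <= N)%N -> (t <= N)%N ->
  ncmul w v t a3 (shadow v u t a2 a1) - ncmul w u t (shadow w v u a3 a2) a1
  - shadow w u t (ncmul w v u a3 a2) a1 + shadow w v t a3 (ncmul v u t a2 a1) = 0.
Proof.
move=> hw hv hu ht.
have := congr1 (@proj _ _) (chi_diff3 (inord w) (inord v) (inord u) (inord t) a3 a2 a1).
by rewrite proj_diff // !projD !projN proj_beta_mx1 // proj_mor !cmul_inord // => {2}->.
Qed.

Lemma shadow_ideal v f g : (shadow i v i f g)`_0 = 0.
Proof. by rewrite /shadow proj_coef0 ?inord_i. Qed.

(** The constant term of the cocycle on the relation at v. *)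
Definition obstruction (v : nat) : k :=
  (shadow v v.-1 v 1 1 - shadow v v.+1 v 1 1)`_0.

Hypothesis obs0 : forall v, (0 < v < N)%N -> v != i -> obstruction v = 0.

(** At v = i the values lie in the ideal, so there is no obstruction there. *)
Lemma obstruction_all v : (0 < v < N)%N -> obstruction v = 0.
Proof.
move=> hv; case: (eqVneq v i) => [->|]; last exact: obs0.
by rewrite /obstruction coefB !shadow_ideal subrr.
Qed.

Let psi := splitting N shadow.

Lemma psi_split (z y x : obj) f g :
  cmul z y x f (psi y x g) + cmul z y x (psi z y f) g - psi z x (cmul z y x f g)
  = proj (chi (ccons z f (arr y g x)) : bhom _ _).
Proof.
rewrite -shadowE.
have N0 : (0 < N)%N by case/andP: hi => i0 iN; apply: leq_trans iN.
have := @splittingP k N N0 shadow (fun w v u g _ _ _ => shadow_linl w v u g)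
  (fun w v u f _ _ _ => shadow_linr w v u f) shadow_cocycle obstruction_all z y x f g
  (ltn_ord z) (ltn_ord y) (ltn_ord x).
by rewrite /ncmul /cmul /psi.
Qed.

Lemma psi_ideal f : (psi i i f)`_0 = 0.
Proof.
case/andP: hi => i0 iN.
apply: (splitting_ideal (leq_trans i0 (ltnW iN))); last exact: ltnW.
by move=> *; apply: shadow_ideal.
Qed.

(** A primitive of the transformation: its first component is the section of the
    primitive of the shadow, and the remaining difference is a boundary, to be
    removed by the second component. *)
Definition primitive1 (z y : obj) a : bhom y z := sect y z (psi z y a).

Definition residue (z y x : obj) a2 a1 : bhom x z :=
  beta_mx1 z y a2 ** primitive1 y x a1 + primitive1 z y a2 ** mor x y a1
  - primitive1 z x (cmul z y x a2 a1) - (chi (ccons z a2 (arr y a1 x)) : bhom x z).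

Definition primitive2 (z y x : obj) a2 a1 : bhom x z :=
  retr (residue z y x a2 a1).

Definition primitive : prenat B := fun x d z p =>
  match p in chain _ _ _ z return bhom x z with
  | cnil => 0
  | ccons d y z a q =>
      match q with
      | cnil => primitive1 z x a
      | ccons d' y' y b r =>
          match r with
          | cnil => primitive2 z y x a b
          | _ => 0
          end
      end
  end.

Lemma proj_primitive1 (z y : obj) a : proj (primitive1 z y a) = psi z y a.
Proof.
rewrite proj_sect // => zi yi.
by rewrite zi yi psi_ideal.
Qed.

Lemma residue_homog (z y x : obj) a2 a1 : twhomog 0 (residue z y x a2 a1).
Proof.
apply: twhomogB; first apply: twhomogB; first apply: twhomogD.
- by rewrite -[0](addr0 0); apply: twhomogM; [exact: beta_mx1_homog | exact: sect_homog].
- by rewrite -[0](addr0 0); apply: twhomogM; [exact: sect_homog | exact: const_homog].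
- exact: sect_homog.
- by case: chiP => h _; case: (h x 2 z) => hom _; apply: hom.
Qed.

(** The residue projects to 0, as the splitting is a primitive of the shadow;
    hence it is the boundary of its retraction. *)
Lemma diff_primitive2 (z y x : obj) a2 a1 :
  tdiff _ ** primitive2 z y x a2 a1 = residue z y x a2 a1.
Proof.
rewrite [RHS]sect_retr; last exact: residue_homog.
rewrite (_ : proj (residue z y x a2 a1) = 0) ?sect0 ?add0r //.
by rewrite /residue !projD !projN proj_beta_mx1 // proj_mor !proj_primitive1 psi_split subrr.
Qed.

Lemma primitive1_linear (z y : obj) c a b :
  primitive1 z y (c *: a + b) = c%:P *: primitive1 z y a + primitive1 z y b.
Proof. by rewrite /primitive1 /psi /splitting lin_of_klinear sect_linear. Qed.

Lemma residue_linl (z y x : obj) c a b a1 :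
  residue z y x (c *: a + b) a1 = c%:P *: residue z y x a a1 + residue z y x b a1.
Proof.
rewrite /residue (chi_lin (slot_here c z a b (arr y a1 x))).
rewrite beta_mx1_linear cmul_linearl !primitive1_linear !twmulDl !twmulZl; mxring.
Qed.

Lemma residue_linr (z y x : obj) c a b a2 :
  residue z y x a2 (c *: a + b) = c%:P *: residue z y x a2 a + residue z y x a2 b.
Proof.
rewrite /residue (chi_lin (slot_there z a2 (slot_here c y a b (cnil k x)))).
rewrite mor_linear cmul_linearr !primitive1_linear !twmulDr !twmulZr; mxring.
Qed.

Lemma primitive_prenat : is_prenat 1 primitive.
Proof.
move=> x d z; split=> [p|c p p1 p2 H].
  case: p => [|d1 y1 z1 a q] /=; first exact: twhomog0.
  case: q => [|d2 y2 z2 b r]; first exact: sect_homog.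
  case: r => [|d3 y3 z3 e r]; first exact: retr_homog.
  exact: twhomog0.
case: H => [d1 y1 z1 a b q|d1 y1 z1 a q q1 q2 H] /=.
  case: q => [|d2 y2 z2 a' q]; first exact: primitive1_linear.
  case: q => [|d3 y3 z3 a'' q]; last by rewrite scaler0 addr0.
  by rewrite /primitive2 residue_linl retrD retrZ.
case: H => [d2 y2 z2 a' b r|d2 y2 z2 a' r r1 r2 H].
  case: r => [|d3 y3 z3 a'' r]; last by rewrite scaler0 addr0.
  by rewrite /primitive2 residue_linr retrD retrZ.
by case: H => *; rewrite scaler0 addr0.
Qed.

(** In arity two this is the definition of the primitive.  In arity three both
    sides have degree -1, and they agree after applying the differential, as
    the third component of a closed transformation is determined by the second
    one. *)
Lemma chi_exact x d z (p : chain k x d z) : chi p = nat_mu1 1 primitive p.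
Proof.
have [hchi cl] := chiP.
have hom := nat_mu1_homog (@beta_mor_homog)
  (fun x d z p => proj1 (primitive_prenat x d z) p).
(* In the other arities both sides have a degree in which beta T_z vanishes. *)
case: (boolP ((d == 2) || (d == 3))) => [/orP[]/eqP dE|dn]; first last.
- rewrite (prenat_vanish p hchi) ?(deg_vanish (hom _ _ _ p)) //; move: dn; lia.
- move: p; rewrite dE => p; have [l [y [a3 [a2 [a1 ->]]]]] := chain3P p.
  have E := @nat_mu1_3_deg1 k N B primitive z l y x a3 a2 a1 erefl erefl.
  rewrite !beta_mor1 beta_mor2 /= in E.
  apply: subr0_eq; apply: diff_inj.
    apply: twhomogB; first by case: (hchi x 3 z) => h _; apply: h.
    exact: hom.
  rewrite twmulBr E chi_diff3 !(twmulDr, twmulNr) diff_beta_mx2; last exact: sect_homog.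
  rewrite [tdiff _ ** (beta_mx1 _ _ _ ** _)]twmulA beta_mx1_chain -[_ ** _ ** primitive2 _ _ _ _ _]twmulA.
  rewrite [tdiff _ ** (primitive2 _ _ _ _ _ ** _)]twmulA !diff_primitive2 /residue.
  rewrite !(twmulDr, twmulDl, twmulNr, twmulNl) -!twmulA mor_mul.
  rewrite (cmulA _ _ _ _ a3 a2 a1).
  mxring.
- move: p; rewrite dE => p; have [y [a2 [a1 ->]]] := chain2P p.
  rewrite (@nat_mu1_2_deg1 k N B primitive z y x a2 a1) // !beta_mor1 /=.
  rewrite diff_primitive2 /residue; mxring.
Qed.

End Cochain.

(** A coboundary takes the same value on the two sides of the relation, up to
    composites of opposite arrows, which are divisible by s. *)
Lemma obstruction_coboundary (chi xi : prenat B) : is_prenat 1 xi ->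
  (forall x d z (p : chain k x d z), chi x d z p = nat_mu1 1 xi p) ->
  forall v, (0 < v < N)%N -> obstruction chi v = 0.
Proof.
move=> hxi E v hv; rewrite /obstruction /shadow !E.
have N2 x y z a2 a1 := @nat_mu1_2_deg1 k N B xi z y x a2 a1
  (prenat_vanish (cnil k x) hxi isT isT).
rewrite !N2 !beta_mor1 !projD !projN !proj_diff // !proj_beta_mx1 // !proj_mor !cmul_inord; try lia.
have d1 : dots v v.-1 v = 1%N by rewrite /dots /dist; lia.
have d2 : dots v v.+1 v = 1%N by rewrite /dots /dist; lia.
by rewrite /ncmul d1 d2 !coefB !coefD !coefN !coefMX /= subrr.
Qed.

Lemma theta_extE (th : theta_space k N i) (j : theta_idx N i) :
  theta_ext th (val (val j)) = th j.
Proof. by rewrite /theta_ext valK /= valK. Qed.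

(** The two paths of the relation contribute theta_v and - theta_v. *)
Lemma obstruction_eta (th : theta_space k N i) (j : theta_idx N i) :
  obstruction (eta th) (val (val j)) = 2%:R * th j.
Proof.
rewrite -theta_extE; case: j => [[v vN] /= /andP[v0 vi]].
have {}vi : v <> i by apply/eqP.
rewrite /obstruction /shadow !eta_sect !proj_sect.
- rewrite !inordK ?(leq_trans vN) //; try lia.
  have -> : 1 = 'X^0 :> {poly k} by rewrite expr0.
  rewrite !coef_cochainX; case: v v0 vN vi => // v _ vN vi.
  have d1 : dots v.+1 v v.+1 = 1%N by rewrite /dots /dist; lia.
  have d2 : dots v.+1 v.+2 v.+1 = 1%N by rewrite /dots /dist; lia.
  rewrite coef_up coef_down /= d1 d2 !add0n subnn -scalerBl opprK coefZ coefXn mulr1.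
  by ring.
- by rewrite !inordK //; lia.
- by rewrite !inordK //; lia.
Qed.

Lemma theta_ext_linear (c : k) (th th' : theta_space k N i) j :
  theta_ext (c *: th + th') j = c * theta_ext th j + theta_ext th' j.
Proof.
rewrite /theta_ext; case: (obind _ _) => [s|] /=; first by rewrite !ffunE.
by rewrite mulr0 addr0.
Qed.

Lemma eta_linear (c : k) (th th' : theta_space k N i) x d z (p : chain k x d z) :
  eta (c *: th + th') p = c%:P *: eta th p + eta th' p.
Proof.
case: (ltnP d 2) => [d2|d2]; first by rewrite !(eta_short _ _ d2) scaler0 addr0.
case: (ltnP 3 d) => [d3|d3]; first by rewrite !(eta_long _ _ d3) scaler0 addr0.
have cE w v b u := @coef_linear _ _ _ _ c w v b u (theta_ext_linear c th th').
apply/matrixP => r s; rewrite !linmxE mul_polyC.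
have z0 : 0 = c *: 0 + 0 :> {poly k} by rewrite scaler0 addr0.
case: (eqVneq d 2) => [dE|dn].
  move: p r s; rewrite dE => p; have [y [a2 [a1 ->]]] := chain2P p => r s.
  rewrite !eta_mx2; apply: lin_of_linear => b; apply: lin_of_linear => a; rewrite /eta2 cE.
  case: ifP => _; first by rewrite scalerDl scalerA.
  case: ifP => _; case: ifP => _ //; first by rewrite scalerDl scalerA.
  by rewrite mulrDr scalerDl scalerA mulrCA.
have dE : d = 3%N by lia.
move: p r s; rewrite dE => p; have [l [y [a3 [a2 [a1 ->]]]]] := chain3P p => r s.
rewrite !eta_mx3; apply: lin_of_linear => e; apply: lin_of_linear => b; apply: lin_of_linear => a.
rewrite /eta3 /coef3 !cE; case: ifP => // _; case: ifP => // _.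
by case: ifP => _; rewrite scalerA -scalerDl; congr (_ *: _); ring.
Qed.

Lemma eta_transf (th : theta_space k N i) : is_nat_transf 2 (eta th).
Proof.
split; last exact: eta_closed.
move=> x d z; split; first by move=> p; apply: eta_homog.
by move=> c p p1 p2; apply: eta_multilin.
Qed.

Lemma transfB (zeta zeta' : prenat B) :
  is_nat_transf 2 zeta -> is_nat_transf 2 zeta' ->
  is_nat_transf 2 (fun x d z p => zeta x d z p - zeta' x d z p).
Proof.
move=> [h cl] [h' cl']; split=> [x d z|x d z p]; last by rewrite nat_mu1B cl cl' subrr.
have [hom lin] := h x d z; have [hom' lin'] := h' x d z.
split=> [p|c p p1 p2 H]; first exact: twhomogB.
by rewrite (lin _ _ _ _ H) (lin' _ _ _ _ H); mxring.
Qed.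

Lemma obstructionB (zeta zeta' : prenat B) v :
  obstruction (fun x d z p => zeta x d z p - zeta' x d z p) v = obstruction zeta v - obstruction zeta' v.
Proof.
by rewrite /obstruction /shadow !projD !projN !coefB; ring.
Qed.

Lemma cohomologous_obstruction (zeta : prenat B) (th : theta_space k N i) (j : theta_idx N i) :
  cohomologous 2 zeta (eta th) -> obstruction zeta (val (val j)) = 2%:R * th j.
Proof.
move=> [xi [hxi E]]; rewrite -obstruction_eta.
apply/eqP; rewrite -subr_eq0 -obstructionB; apply/eqP; apply: (obstruction_coboundary hxi) => //.
by case: j => [[v vN] /= /andP[-> _]].
Qed.

(** The difference from eta has no obstruction, so it has a primitive. *)
Lemma obstruction_cohomologous (zeta : prenat B) (th : theta_space k N i) :
  is_nat_transf 2 zeta ->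
  (forall j : theta_idx N i, obstruction zeta (val (val j)) = 2%:R * th j) ->
  cohomologous 2 zeta (eta th).
Proof.
move=> hz E.
have hchi := transfB hz (eta_transf th).
have obs0 v : (0 < v < N)%N -> v != i ->
    obstruction (fun x d z p => zeta x d z p - eta th p) v = 0.
  move=> /andP[v0 vN] vi.
  have hv : (0 < Ordinal vN)%N && (val (Ordinal vN) != i) by rewrite v0.
  pose j : theta_idx N i := Sub (Ordinal vN) hv.
  by rewrite obstructionB (E j) (obstruction_eta th j) subrr.
exists (primitive (fun x d z p => zeta x d z p - eta th p)).
split; first exact: primitive_prenat.
by move=> x d z p; rewrite -(chi_exact hchi obs0).
Qed.

End Braiding.

Theorem theorem9p10 (k : fieldType) (k2 : (2%:R : k) != 0)
    (N i : nat) (hi : (0 < i < N)%N) :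
  (forall th : theta_space k N i, is_nat_transf 2 (eta th)) /\
  (forall (c : k) (th th' : theta_space k N i) x d z (p : chain k x d z),
     eta (c *: th + th') p = c%:P *: eta th p + eta th' p) /\
  (forall zeta : prenat (beta k N i), is_nat_transf 2 zeta ->
     exists! th : theta_space k N i, cohomologous 2 zeta (eta th)).
Proof.
split; first exact: (eta_transf hi k2); split; first exact: eta_linear.
move=> zeta hz.
(* On eta the obstruction is twice the parameter. *)
exists [ffun j : theta_idx N i => 2^-1 * obstruction zeta (val (val j)) : k^o].
split=> [|th hth].
  apply: (obstruction_cohomologous hi k2 hz) => j.
  by rewrite ffunE mulrA mulfV // mul1r.
apply/ffunP => j; rewrite ffunE (cohomologous_obstruction hi k2 j hth).
by rewrite mulrA mulVf // mul1r.
Qed.
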